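(* Let $\kappa$ be of class $\mathcal{G}_2(2,0)$ and $f\in C^2[0,1]$. Let $\varphi$ be the unique solution of $x-\mathcal{K}(x)=f$ and assume that $1$ is not an eigenvalue of $\mathcal{K}'(\varphi)$. Let $\mathcal{X}_n$ be the space of piecewise constant functions with respect to the uniform partition $\{t_j=j/n\}$ and $Q_n:L^\infty[0,1]\to\mathcal{X}_n$ the discrete orthogonal projection (based on the composite Gauss two-point rule). Let $z_n^M$ be the discrete modified projection solution in $\mathcal{B}(\varphi,\delta_0)$. Then $$\|z_n^M-\varphi\|_\infty=O\big(\max\{\tilde h^{2},h^{3}\}\big).$$
   Context: Setting. $\mathcal{X}=L^\infty[0,1]$ with sup norm. A kernel $\kappa:[0,1]\times[0,1]\times\mathbb{R}\to\mathbb{R}$ is of class $\mathcal{G}_2(2,0)$ if: (1) $\ell=\partial\kappa/\partial u$ is continuous on $\Psi=[0,1]^2\times\mathbb{R}$; (2) with $\Psi_1=\{0\le t\le s\le1,u\in\mathbb{R}\}$, $\Psi_2=\{0\le s\le t\le1,u\in\mathbb{R}\}$, there are $\ell_i\in C^{2}(\Psi_i)$ with $\ell=\ell_i$ on $\Psi_i$; (3) there are $\kappa_i\in C^{2}(\Psi_i)$ with $\kappa=\kappa_i$ on $\Psi_i$; (4) $\partial^2\kappa/\partial u^2$ is continuous on $\Psi$. $\mathcal{K}(x)(s)=\int_0^1\kappa(s,t,x(t))dt$, assumed twice Fréchet differentiable. Quadrature: Gauss two-point rule with $w_1=w_2=1/2$, $\mu_{1,2}=\tfrac12\mp\tfrac1{2\sqrt3}$.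 For $n,p\in\mathbb{N}$, $m=np$, $h=1/n$, $\tilde h=1/m$, $s_i=i/m$, $\zeta_q^i=s_{i-1}+\mu_q\tilde h$. Nyström operator $\mathcal{K}_m(x)(s)=\tilde h\sum_{i=1}^m\sum_{q=1}^2 w_q\kappa(s,\zeta_q^i,x(\zeta_q^i))$. Projection: $t_j=j/n$; $\mathcal{X}_n$ consists of functions constant on $[t_0,t_1]$ and on each $(t_{j-1},t_j]$, $j\ge2$. For $v\in C[0,1]$, $(Q_nv)(t)=\frac1p\sum_{\nu=1}^p\sum_{q=1}^2w_qv(\zeta_q^{(j-1)p+\nu})$ for $t\in(t_{j-1},t_j]$ (and at $t=0$ with $j=1$); $Q_n$ is extended to a bounded projection on $L^\infty[0,1]$ via Hahn–Banach. Method: $\tilde{\mathcal{K}}_n^M(x)=Q_n\mathcal{K}_m(x)+\mathcal{K}_m(Q_nx)-Q_n\mathcal{K}_m(Q_nx)$. There is $\delta_0>0$ such that for $n$ large enough $z-\tilde{\mathcal{K}}_n^M(z)=f$ has a unique solution $z_n^M$ in $\mathcal{B}(\varphi,\delta_0)=\{\psi:\|\psi-\varphi\|_\infty<\delta_0\}$. Notation: $A=O(B)$ means $|A|\le CB$ with $C$ independent of $n,p$, for all sufficiently large $n$. *)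

(* Defs.v *)
From HB Require Import structures.
From mathcomp Require Import all_boot all_order all_algebra.
From mathcomp Require Import all_classical all_reals all_analysis.
Set Implicit Arguments. Unset Strict Implicit. Unset Printing Implicit Defensive.
Import Order.TTheory GRing.Theory Num.Theory.
Import numFieldNormedType.Exports.
Local Open Scope classical_set_scope.
Local Open Scope ring_scope.

Section Defs.
Variable R : realType.

Definition I01 : set R := `[0, 1]%classic.

Definition eqI (x y : R -> R) : Prop := forall t, I01 t -> x t = y t.

Definition Xsp (x : R -> R) : Prop :=
  measurable_fun I01 x /\ exists M : R, forall t, I01 t -> `|x t| <= M.

Definition supn (x : R -> R) : R := sup [set `|x t| | t in I01].

Definition fadd (x y : R -> R) : R -> R := fun t => x t + y t.
Definition fsub (x y : R -> R) : R -> R := fun t => x t - y t.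
Definition fscale (a : R) (x : R -> R) : R -> R := fun t => a * x t.

Definition cont3 (g : R -> R -> R -> R) : Prop :=
  continuous (fun v : R * R * R => g v.1.1 v.1.2 v.2).
Definition cont3_on (A : set (R * R * R)) (g : R -> R -> R -> R) : Prop :=
  {within A, continuous (fun v : R * R * R => g v.1.1 v.1.2 v.2)}.

Definition pd1 (g : R -> R -> R -> R) : R -> R -> R -> R :=
  fun s t u => derive1 (fun a => g a t u) s.
Definition pd2 (g : R -> R -> R -> R) : R -> R -> R -> R :=
  fun s t u => derive1 (fun a => g s a u) t.
Definition pd3 (g : R -> R -> R -> R) : R -> R -> R -> R :=
  fun s t u => derive1 (fun a => g s t a) u.

Definition C1_3 (g : R -> R -> R -> R) : Prop :=
  cont3 g /\
  (forall s t u, derivable (fun a => g a t u) s 1 /\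
                 derivable (fun a => g s a u) t 1 /\
                 derivable (fun a => g s t a) u 1) /\
  cont3 (pd1 g) /\ cont3 (pd2 g) /\ cont3 (pd3 g).

Definition C2_3 (g : R -> R -> R -> R) : Prop :=
  C1_3 g /\ C1_3 (pd1 g) /\ C1_3 (pd2 g) /\ C1_3 (pd3 g).

Definition Psi : set (R * R * R) :=
  [set v | 0 <= v.1.1 <= 1 /\ 0 <= v.1.2 <= 1].
Definition Psi1 : set (R * R * R) :=
  [set v | 0 <= v.1.2 /\ v.1.2 <= v.1.1 /\ v.1.1 <= 1].
Definition Psi2 : set (R * R * R) :=
  [set v | 0 <= v.1.1 /\ v.1.1 <= v.1.2 /\ v.1.2 <= 1].

Definition C2_on (A : set (R * R * R)) (g : R -> R -> R -> R) : Prop :=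
  exists G, C2_3 G /\ forall v, A v -> g v.1.1 v.1.2 v.2 = G v.1.1 v.1.2 v.2.

Definition class_G2_2_0 (kappa : R -> R -> R -> R) : Prop :=
  let ell := pd3 kappa in
  ((forall s t u, Psi (s, t, u) -> derivable (fun a => kappa s t a) u 1) /\
   cont3_on Psi ell) /\
  (exists ell1 ell2, C2_on Psi1 ell1 /\ C2_on Psi2 ell2 /\
     (forall v, Psi1 v -> ell v.1.1 v.1.2 v.2 = ell1 v.1.1 v.1.2 v.2) /\
     (forall v, Psi2 v -> ell v.1.1 v.1.2 v.2 = ell2 v.1.1 v.1.2 v.2)) /\
  (exists kappa1 kappa2, C2_on Psi1 kappa1 /\ C2_on Psi2 kappa2 /\
     (forall v, Psi1 v -> kappa v.1.1 v.1.2 v.2 = kappa1 v.1.1 v.1.2 v.2) /\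
     (forall v, Psi2 v -> kappa v.1.1 v.1.2 v.2 = kappa2 v.1.1 v.1.2 v.2)) /\
  ((forall s t u, Psi (s, t, u) -> derivable (fun a => ell s t a) u 1) /\
   cont3_on Psi (pd3 ell)).

Definition C2_01 (f : R -> R) : Prop :=
  exists g : R -> R,
    (forall t, derivable g t 1) /\ (forall t, derivable (derive1 g) t 1) /\
    continuous (derive1 (derive1 g)) /\ eqI f g.

Definition Kop (kappa : R -> R -> R -> R) (x : R -> R) : R -> R :=
  fun s => (\int[lebesgue_measure]_(t in I01) kappa s t (x t))%R.

(** Gauss two-point rule *)
Definition gw : R := 1 / 2.
Definition gmu (q : nat) : R :=
  if q == 1%N then 1 / 2 - 1 / (2 * Num.sqrt 3) else 1 / 2 + 1 / (2 * Num.sqrt 3).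

(** nodes zeta_q^i = s_{i-1} + mu_q / m, with s_i = i/m, for 1 <= i <= m *)
Definition zeta (m i q : nat) : R := (i.-1)%:R / m%:R + gmu q / m%:R.

Definition Kmop (kappa : R -> R -> R -> R) (n p : nat) (x : R -> R) : R -> R :=
  let m := (n * p)%N in
  fun s => (1 / m%:R) * \sum_(1 <= i < m.+1) \sum_(1 <= q < 3)
             gw * kappa s (zeta m i q) (x (zeta m i q)).

Definition cell (n j : nat) (t : R) : Prop :=
  (1 <= j <= n)%N /\
  (((j.-1)%:R / n%:R < t) \/ (j = 1%N /\ t = 0)) /\ t <= j%:R / n%:R.

Definition Xn (n : nat) (x : R -> R) : Prop :=
  exists c : nat -> R, forall j t, cell n j t -> x t = c j.

(** the value of the discrete orthogonal projection on the j-th cell *)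
Definition qavg (n p j : nat) (v : R -> R) : R :=
  let m := (n * p)%N in
  (1 / p%:R) * \sum_(1 <= nu < p.+1) \sum_(1 <= q < 3)
     gw * v (zeta m ((j.-1) * p + nu)%N q).

(** Q is an admissible extension of the discrete orthogonal projection
    Q_n (for given n, p) to a bounded projection on the whole space *)
Definition is_Qn (n p : nat) (Q : (R -> R) -> (R -> R)) : Prop :=
  (forall a x y, Xsp x -> Xsp y ->
     eqI (Q (fadd (fscale a x) y)) (fadd (fscale a (Q x)) (Q y))) /\
  (forall x, Xsp x -> Xsp (Q x) /\ Xn n (Q x)) /\
  (forall x, Xsp x -> Xn n x -> eqI (Q x) x) /\
  (exists c : R, forall x, Xsp x -> supn (Q x) <= c * supn x) /\
  (forall v, {within I01, continuous v} ->
     forall j t, cell n j t -> Q v t = qavg n p j v).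

Definition KtM (kappa : R -> R -> R -> R) (n p : nat)
    (Q : (R -> R) -> (R -> R)) (x : R -> R) : R -> R :=
  fsub (fadd (Q (Kmop kappa n p x)) (Kmop kappa n p (Q x)))
       (Q (Kmop kappa n p (Q x))).

Definition bounded_linear (L : (R -> R) -> (R -> R)) : Prop :=
  (forall a x y, Xsp x -> Xsp y ->
     eqI (L (fadd (fscale a x) y)) (fadd (fscale a (L x)) (L y))) /\
  (forall x, Xsp x -> Xsp (L x)) /\
  (exists c : R, forall x, Xsp x -> supn (L x) <= c * supn x).

Definition is_fderiv (F : (R -> R) -> (R -> R)) (x : R -> R)
    (L : (R -> R) -> (R -> R)) : Prop :=
  bounded_linear L /\
  forall eps : R, 0 < eps -> exists delta : R, 0 < delta /\
    forall v, Xsp v -> supn v < delta ->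
      supn (fsub (fsub (F (fadd x v)) (F x)) (L v)) <= eps * supn v.

Definition twice_fdiff (F : (R -> R) -> (R -> R)) : Prop :=
  exists (DF : (R -> R) -> (R -> R) -> (R -> R))
         (D2F : (R -> R) -> (R -> R) -> (R -> R) -> (R -> R)),
    forall x, Xsp x ->
      is_fderiv F x (DF x) /\
      (forall v, Xsp v -> bounded_linear (D2F x v)) /\
      (forall w, Xsp w -> bounded_linear (fun v => D2F x v w)) /\
      (exists c : R, forall v w, Xsp v -> Xsp w ->
          supn (D2F x v w) <= c * supn v * supn w) /\
      (* D2F x is the Frechet derivative of DF at x (operator norm) *)
      (forall eps : R, 0 < eps -> exists delta : R, 0 < delta /\
        forall v, Xsp v -> supn v < delta -> forall w, Xsp w ->
          supn (fsub (fsub (DF (fadd x v) w) (DF x w)) (D2F x v w))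
            <= eps * supn v * supn w).

End Defs.

(* Main.v *)
(* The proof is by compactness and contradiction. Write K_m for the Nystrom
   operator, u = Q_n z and h = 1/n. Applying Q_n to the discrete equation gives
   u = Q_n (f + K_m z), so only values of Q_n on continuous functions matter and
   z is within O(h) of the equi-Lipschitz function f + K_m z; a uniform cluster
   point solves the original equation, hence equals phi, and z tends to phi.

   The consistency error of phi splits as (K_m phi - K phi) minus
   (I - Q_n)(K_m phi - K_m Q_n phi). The first term is O(1/m^2), although the
   kernel has a kink on the diagonal, because phi is C^(1,1) and the kink only
   affects one fine cell. In the second, K_m phi - K_m Q_n phi has Lipschitz
   constant O(h^2), since phi - Q_n phi has zero mean on each coarse cell, and
   I - Q_n gains a further factor h.

   With r = ||z - phi||, the error e = z - phi then satisfies
   e = K_m'(phi) e + O(max(1/m^2, h^3) + h r + r^2). If r were not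
   O(max(1/m^2, h^3)), a uniform cluster point of K_m'(phi) e / r would be an
   eigenfunction of K'(phi) for the eigenvalue 1. *)
Require Import Defs.
From HB Require Import structures.
From mathcomp Require Import all_boot all_order all_algebra.
From mathcomp Require Import all_classical all_reals all_analysis.
From mathcomp Require Import measurable_realfun ring lra.
Set Implicit Arguments. Unset Strict Implicit. Unset Printing Implicit Defensive.
Import Order.TTheory GRing.Theory Num.Theory.
Import numFieldNormedType.Exports.
Local Open Scope classical_set_scope.
Local Open Scope ring_scope.

(** * Calculus on a box *)

Section BoxCalculus.
Variable R : realType.
Implicit Types (g : R -> R) (G : R -> R -> R -> R) (B M : R).

(** The extension of Q_n carries no norm bound uniform in n and p. The linearization is possible
    because Q_n z - Q_n phi = Q_n (K_m z - K phi), a cell average of a continuous function, so the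
    size of the extension never enters. A second obstacle is that delta0 is fixed and not small:
    nothing makes the quadratic remainder r^2 negligible beforehand, so plain convergence has to
    precede the rate. In both compactness arguments p varies freely with n; every constant is
    therefore independent of both, and only 1/n is known to become small. Derivatives of the kernel
    are bounded only locally in u, hence all estimates live on boxes |u| <= B. *)

Lemma mvt_in g (a b x y : R) : (forall z, derivable g z 1) ->
  a <= x <= b -> a <= y <= b ->
  exists c, [/\ a <= c <= b, `|c - x| <= `|y - x| &
    g y - g x = derive1 g c * (y - x)].
Proof.
move=> dg hx hy.
have dg' (z : R) : is_derive z (1 : R) g (derive1 g z).
  by rewrite derive1E; apply: DeriveDef.
have cg (A : set R) : {within A, continuous g}.
  apply: continuous_subspaceT => z.
  exact/differentiable_continuous/derivable1_diffP.
have [xy|yx] := leP x y.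
  have [c hc e] := MVT_segment xy (fun z _ => dg' z) (cg _).
  move: hc; rewrite in_itv/= => hc; exists c; split => //; first by lra.
  by rewrite !ger0_norm; lra.
have [c hc e] := MVT_segment (ltW yx) (fun z _ => dg' z) (cg _).
move: hc; rewrite in_itv/= => hc; exists c; split => //; first by lra.
  by rewrite !ler0_norm; lra.
by rewrite -opprB e; ring.
Qed.

Lemma lip_of_derive1 g (a b M x y : R) : (forall z, derivable g z 1) ->
  (forall z, a <= z <= b -> `|derive1 g z| <= M) ->
  a <= x <= b -> a <= y <= b -> `|g x - g y| <= M * `|x - y|.
Proof.
move=> dg hM hx hy; have [c [hc _ ->]] := mvt_in dg hy hx.
by rewrite normrM ler_wpM2r// hM.
Qed.

(** The mean value theorem puts the slope at a point no farther from [x] than [y] is, whence [M] and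
    not the sharper [M / 2]; the derivative is compared with its value at [x] only. *)
Lemma taylor1_of_lip g (a b M x y : R) : (forall z, derivable g z 1) ->
  0 <= M ->
  (forall z, a <= z <= b -> `|derive1 g z - derive1 g x| <= M * `|z - x|) ->
  a <= x <= b -> a <= y <= b ->
  `|g y - g x - derive1 g x * (y - x)| <= M * `|y - x| ^+ 2.
Proof.
move=> dg M0 hM hx hy; have [c [hc cx ->]] := mvt_in dg hx hy.
rewrite -mulrBl normrM expr2 mulrA ler_wpM2r//.
by apply: (le_trans (hM _ hc)); rewrite ler_wpM2l.
Qed.

Definition box B (s t u : R) := [/\ 0 <= s <= 1, 0 <= t <= 1 & - B <= u <= B].

Definition lip_box B M G := forall s t u s' t' u',
  box B s t u -> box B s' t' u' ->
  `|G s t u - G s' t' u'| <= M * (`|s - s'| + `|t - t'| + `|u - u'|).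

Lemma cont3_box_bounded B G : cont3 G ->
  exists2 M, 0 <= M & forall s t u, box B s t u -> `|G s t u| <= M.
Proof.
move=> cG; pose g (v : R * R * R) := G v.1.1 v.1.2 v.2.
pose A : set (R * R * R) := (`[0, 1] `*` `[0, 1]) `*` `[- B, B].
have cA : compact A.
  by apply: compact_setX; [apply: compact_setX|]; exact: segment_compact.
have cgA : compact (g @` A).
  by apply: continuous_compact cA; exact: continuous_subspaceT.
have [M0 [_ hM]] := compact_bounded cgA.
exists (`|M0| + 1); first by rewrite addr_ge0.
move=> s t u [hs ht hu].
apply: (hM (`|M0| + 1)); first by rewrite (le_lt_trans (ler_norm _))// ltrDl.
by exists (s, t, u) => //=; rewrite !in_itv.
Qed.

Lemma C1_lip_box B G : C1_3 G -> exists2 M, 0 <= M &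
  lip_box B M G /\ forall s t u, box B s t u -> `|G s t u| <= M.
Proof.
move=> [cG [dG [c1 [c2 c3]]]].
have [M0 M00 h0] := cont3_box_bounded B cG.
have [M1 M10 h1] := cont3_box_bounded B c1.
have [M2 M20 h2] := cont3_box_bounded B c2.
have [M3 M30 h3] := cont3_box_bounded B c3.
exists (M0 + M1 + M2 + M3); first by rewrite !addr_ge0.
split; last by move=> s t u /h0 h; rewrite -!addrA ler_wpDr// !addr_ge0.
move=> s t u s' t' u' [hs ht hu] [hs' ht' hu'].
have e1 : `|G s t u - G s' t u| <= M1 * `|s - s'|.
  apply: (@lip_of_derive1 (fun a => G a t u) 0 1) => //.
    exact: (fun z => (dG z t u).1).
  by move=> z hz; exact: h1.
have e2 : `|G s' t u - G s' t' u| <= M2 * `|t - t'|.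
  apply: (@lip_of_derive1 (fun a => G s' a u) 0 1) => //.
    exact: (fun z => (dG s' z u).2.1).
  by move=> z hz; exact: h2.
have e3 : `|G s' t' u - G s' t' u'| <= M3 * `|u - u'|.
  apply: (@lip_of_derive1 (fun a => G s' t' a) (- B) B) => //.
    exact: (fun z => (dG s' t' z).2.2).
  by move=> z hz; exact: h3.
have -> : G s t u - G s' t' u' = (G s t u - G s' t u) +
  (G s' t u - G s' t' u) + (G s' t' u - G s' t' u') by ring.
apply: (le_trans (ler_normD _ _)); apply: (le_trans (lerD (ler_normD _ _) (lexx _))).
have := normr_ge0 (s - s'); have := normr_ge0 (t - t').
have := normr_ge0 (u - u').
move: e1 e2 e3; nra.
Qed.

(** What survives of C^2 are Lipschitz bounds on the first derivatives: each later Taylor estimate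
    is a mean value step followed by one of these. *)
Record C2_box B M G : Prop := {
  c2b_ge0 : 0 <= M ;
  c2b_der1 : forall s t u, derivable (fun a => G a t u) s 1 ;
  c2b_der2 : forall s t u, derivable (fun a => G s a u) t 1 ;
  c2b_der3 : forall s t u, derivable (fun a => G s t a) u 1 ;
  c2b_bnd : forall s t u, box B s t u -> `|G s t u| <= M ;
  c2b_bnd1 : forall s t u, box B s t u -> `|pd1 G s t u| <= M ;
  c2b_bnd3 : forall s t u, box B s t u -> `|pd3 G s t u| <= M ;
  c2b_lip : lip_box B M G ;
  c2b_lip1 : lip_box B M (pd1 G) ;
  c2b_lip2 : lip_box B M (pd2 G) ;
  c2b_lip3 : lip_box B M (pd3 G) }.

Lemma lip_boxW B M M' G : M <= M' -> lip_box B M G -> lip_box B M' G.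
Proof.
move=> MM h s t u s' t' u' b b'; apply: (le_trans (h _ _ _ _ _ _ b b')).
by rewrite ler_wpM2r// !addr_ge0.
Qed.

Lemma C2_boxW B M M' G : M <= M' -> C2_box B M G -> C2_box B M' G.
Proof.
move=> MM [? d1 d2 d3 b b1 b3 l l1 l2 l3].
have bW F : (forall s t u, box B s t u -> `|F s t u| <= M) ->
  forall s t u, box B s t u -> `|F s t u| <= M'.
  by move=> h s t u /h /le_trans; apply.
split; [exact: le_trans MM|exact: d1|exact: d2|exact: d3|exact: bW b|
  exact: bW b1|exact: bW b3|exact: lip_boxW l|exact: lip_boxW l1|
  exact: lip_boxW l2|exact: lip_boxW l3].
Qed.

Lemma C2_boxP B G : C2_3 G -> exists M, C2_box B M G.
Proof.
move=> [C [C1 [C2 C3]]].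
have [M M0 [l b]] := C1_lip_box B C.
have [M1 M10 [l1 b1]] := C1_lip_box B C1.
have [M2 M20 [l2 _]] := C1_lip_box B C2.
have [M3 M30 [l3 b3]] := C1_lip_box B C3.
have [_ [dG _]] := C.
exists (M + M1 + M2 + M3); split; first by rewrite !addr_ge0.
- exact: (fun s t u => (dG s t u).1).
- exact: (fun s t u => (dG s t u).2.1).
- exact: (fun s t u => (dG s t u).2.2).
- by move=> s t u /b; lra.
- by move=> s t u /b1; lra.
- by move=> s t u /b3; lra.
- by apply: lip_boxW l; lra.
- by apply: lip_boxW l1; lra.
- by apply: lip_boxW l2; lra.
- by apply: lip_boxW l3; lra.
Qed.

(** The difference of two sections in the first variable has a difference of values of [pd1 G] as
    derivative, small by the Lipschitz bound. This yields a product of increments without any mixed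
    second derivative. *)
Lemma C2_box_mixed B M G s s' t t' u u' : C2_box B M G ->
  box B s t u -> box B s' t' u' ->
  `|G s t u - G s' t u - (G s t' u' - G s' t' u')| <=
    M * `|s - s'| * (`|t - t'| + `|u - u'|).
Proof.
move=> H [hs ht hu] [hs' ht' hu'].
have -> : G s t u - G s' t u - (G s t' u' - G s' t' u') =
  (G s t u - G s t' u') - (G s' t u - G s' t' u') by ring.
have d1 (z t0 u0 : R) : is_derive z (1 : R) (fun a => G a t0 u0) (pd1 G z t0 u0).
  by rewrite /pd1 derive1E; apply: DeriveDef; [exact: (c2b_der1 H)|].
have dd (z : R) : is_derive z (1 : R) (fun a => G a t u - G a t' u')
    (pd1 G z t u - pd1 G z t' u').
  exact: is_deriveB.
rewrite mulrAC.
apply: (@lip_of_derive1 (fun a => G a t u - G a t' u') 0 1) => //.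
move=> z hz; rewrite derive1E (@derive_val _ _ _ _ _ _ _ (dd z)).
have := @c2b_lip1 _ _ _ H z t u z t' u'; rewrite subrr normr0 add0r; exact.
Qed.

Lemma C2_box_taylor1 B M G s c t u : C2_box B M G ->
  box B s t u -> box B c t u ->
  `|G s t u - G c t u - pd1 G c t u * (s - c)| <= M * `|s - c| ^+ 2.
Proof.
move=> H [hs ht hu] [hc _ _].
apply: (@taylor1_of_lip (fun a => G a t u) 0 1) => //.
- by move=> z; exact: (c2b_der1 H).
- exact: c2b_ge0 H.
- move=> z hz; have := @c2b_lip1 _ _ _ H z t u c t u.
  by rewrite !subrr !normr0 !addr0; apply.
Qed.

(** The increment runs along [t] at height [u], then along [u] at [c]; both intermediate points stay
    within |t - c| + |u - w| of the base point. *)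
Lemma C2_box_taylor23 B M G s t u c w : C2_box B M G ->
  box B s t u -> box B s c w ->
  `|G s t u - G s c w - (pd2 G s c w * (t - c) + pd3 G s c w * (u - w))| <=
    M * (`|t - c| + `|u - w|) ^+ 2.
Proof.
move=> H [hs ht hu] [_ hc hw]; have M0 := c2b_ge0 H.
have [x [hx xc ex]] := mvt_in (g := fun a => G s a u)
  (fun z => @c2b_der2 _ _ _ H s z u) hc ht.
have [y [hy yw ey]] := mvt_in (g := fun a => G s c a)
  (fun z => @c2b_der3 _ _ _ H s c z) hw hu.
have -> : G s t u - G s c w - (pd2 G s c w * (t - c) + pd3 G s c w * (u - w)) =
  (pd2 G s x u - pd2 G s c w) * (t - c) + (pd3 G s c y - pd3 G s c w) * (u - w).
  by move: ex ey; rewrite -/(pd2 G s x u) -/(pd3 G s c y) => ex ey; lra.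
apply: (le_trans (ler_normD _ _)); rewrite !normrM.
have b1 : `|pd2 G s x u - pd2 G s c w| <= M * (`|t - c| + `|u - w|).
  have := @c2b_lip2 _ _ _ H s x u s c w; rewrite subrr normr0 add0r => h.
  by apply: (le_trans (h _ _)) => //; rewrite ler_wpM2l// lerD2r.
have b2 : `|pd3 G s c y - pd3 G s c w| <= M * (`|t - c| + `|u - w|).
  have := @c2b_lip3 _ _ _ H s c y s c w; rewrite !subrr normr0 !add0r => h.
  by apply: (le_trans (h _ _)) => //; rewrite ler_wpM2l// ler_wpDl.
rewrite expr2 mulrA [leRHS]mulrDr.
by apply: lerD; rewrite ler_wpM2r.
Qed.

End BoxCalculus.

(** * Kernels glued along the diagonal *)

Section Kernel.
Variable R : realType.
Implicit Types (k g : R -> R -> R -> R) (B M s t u : R).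

(** Both formulas hold on the diagonal, so continuity across it is built in, while derivatives may
    jump there. *)
Definition glued k g1 g2 :=
  (forall s t u, 0 <= t -> t <= s -> s <= 1 -> k s t u = g1 s t u) /\
  (forall s t u, 0 <= s -> s <= t -> t <= 1 -> k s t u = g2 s t u).

(** Inserting [f c] loses nothing, because the distances to an intermediate [c] add up. With [c] on
    the diagonal this makes a glued kernel Lipschitz on the whole box. *)
Lemma lip_split (f : R -> R) (c M : R) : 0 <= c <= 1 ->
  (forall a b, 0 <= a -> a <= b -> b <= 1 -> b <= c \/ c <= a ->
    `|f b - f a| <= M * `|b - a|) ->
  forall x y, 0 <= x <= 1 -> 0 <= y <= 1 -> `|f x - f y| <= M * `|x - y|.
Proof.
move=> /andP[c0 c1] h.
have le_f x y : 0 <= x -> x <= y -> y <= 1 -> `|f y - f x| <= M * `|y - x|.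
  move=> x0 xy y1; have [yc|cy] := orP (le_total y c); first by apply: h => //; left.
  have [cx|xc] := orP (le_total c x); first by apply: h => //; right.
  have -> : f y - f x = (f y - f c) + (f c - f x) by ring.
  apply: (le_trans (ler_normD _ _)).
  have -> : `|y - x| = `|y - c| + `|c - x|.
    by rewrite !ger0_norm ?subr_ge0//; ring.
  rewrite mulrDr; apply: lerD; apply: h => //; [by right|by left].
move=> x y /andP[x0 x1] /andP[y0 y1]; have [xy|xy] := orP (le_total y x); first exact: le_f.
by rewrite distrC [X in _ * X]distrC; exact: le_f.
Qed.

Lemma glued_lip k g1 g2 B M : glued k g1 g2 ->
  C2_box B M g1 -> C2_box B M g2 -> lip_box B M k.
Proof.
move=> [e1 e2] H1 H2 s t u s' t' u' [hs ht hu] [hs' ht' hu'].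
have bx a b v : 0 <= a <= 1 -> 0 <= b <= 1 -> - B <= v <= B -> box B a b v by [].
have E1 : `|k s t u - k s' t u| <= M * `|s - s'|.
  apply: (@lip_split (fun a => k a t u) t) => // a b a0 ab b1.
  have [ha hb] : 0 <= a <= 1 /\ 0 <= b <= 1.
    by rewrite a0 b1 (le_trans ab b1) (le_trans a0 ab).
  have [t0 t1] := andP ht.
  case=> [bt|ta].
    rewrite !e2 ?(le_trans a0)// ?(le_trans ab)//.
    have := c2b_lip H2 (bx _ _ _ hb ht hu) (bx _ _ _ ha ht hu).
    by rewrite !subrr normr0 !addr0.
  rewrite !e1 ?(le_trans ta)// ?(le_trans ab)//.
  have := c2b_lip H1 (bx _ _ _ hb ht hu) (bx _ _ _ ha ht hu).
  by rewrite !subrr normr0 !addr0.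
have E2 : `|k s' t u - k s' t' u| <= M * `|t - t'|.
  apply: (@lip_split (fun a => k s' a u) s') => // a b a0 ab b1.
  have [ha hb] : 0 <= a <= 1 /\ 0 <= b <= 1.
    by rewrite a0 b1 (le_trans ab b1) (le_trans a0 ab).
  have [s0 s1] := andP hs'.
  case=> [bt|ta].
    rewrite !e1 ?(le_trans a0)// ?(le_trans ab)//.
    have := c2b_lip H1 (bx _ _ _ hs' hb hu) (bx _ _ _ hs' ha hu).
    by rewrite !subrr normr0 addr0 add0r.
  rewrite !e2 ?(le_trans ta)// ?(le_trans ab)//.
  have := c2b_lip H2 (bx _ _ _ hs' hb hu) (bx _ _ _ hs' ha hu).
  by rewrite !subrr normr0 addr0 add0r.
have E3 : `|k s' t' u - k s' t' u'| <= M * `|u - u'|.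
  have [s0 s1] := andP hs'; have [t0 t1] := andP ht'.
  have [st|ts] := orP (le_total s' t').
    have := c2b_lip H2 (bx _ _ _ hs' ht' hu) (bx _ _ _ hs' ht' hu').
    by rewrite !subrr normr0 !add0r !e2.
  have := c2b_lip H1 (bx _ _ _ hs' ht' hu) (bx _ _ _ hs' ht' hu').
  by rewrite !subrr normr0 !add0r !e1.
have -> : k s t u - k s' t' u' = (k s t u - k s' t u) +
  (k s' t u - k s' t' u) + (k s' t' u - k s' t' u') by ring.
apply: (le_trans (ler_normD _ _)).
apply: (le_trans (lerD (ler_normD _ _) (lexx _))).
by rewrite !mulrDr; apply: lerD => //; apply: lerD.
Qed.

Lemma glued_bounded k g1 g2 B M : glued k g1 g2 ->
  C2_box B M g1 -> C2_box B M g2 ->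
  forall s t u, box B s t u -> `|k s t u| <= M.
Proof.
move=> [e1 e2] H1 H2 s t u [hs ht hu].
have [ts|st] := leP t s.
  by rewrite e1; try lra; apply: (c2b_bnd H1).
by rewrite e2; try lra; apply: (c2b_bnd H2).
Qed.

(** The pieces are C^2 on the whole space, so mean value arguments may leave the triangles. The
    separate pieces of [pd3 k] supply one more derivative than those of [k], as the third-order
    estimate requires. *)
Record kernel_pieces k k1 k2 l1 l2 : Prop := {
  kp_k : glued k k1 k2 ;
  kp_l : glued (pd3 k) l1 l2 ;
  kp_der : forall s t u, 0 <= s <= 1 -> 0 <= t <= 1 ->
    derivable (fun a => k s t a) u 1 ;
  kp_k1 : C2_3 k1 ; kp_k2 : C2_3 k2 ; kp_l1 : C2_3 l1 ; kp_l2 : C2_3 l2 }.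

Lemma class_G2_pieces k : class_G2_2_0 k ->
  exists k1 k2 l1 l2, kernel_pieces k k1 k2 l1 l2.
Proof.
move=> [[dk _] [[l1 [l2 [[L1 [CL1 eL1]] [[L2 [CL2 eL2]] [el1 el2]]]]] [
  [k1 [k2 [[K1 [CK1 eK1]] [[K2 [CK2 eK2]] [ek1 ek2]]]]] _]]].
exists K1, K2, L1, L2; split => //.
- split=> s t u h1 h2 h3.
    by rewrite (ek1 (s, t, u)) ?(eK1 (s, t, u)).
  by rewrite (ek2 (s, t, u)) ?(eK2 (s, t, u)).
- split=> s t u h1 h2 h3.
    by rewrite (el1 (s, t, u)) ?(eL1 (s, t, u)).
  by rewrite (el2 (s, t, u)) ?(eL2 (s, t, u)).
- by move=> s t u hs ht; apply: dk.
Qed.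

Record kernel_bound k k1 k2 l1 l2 B M : Prop := {
  kb_k : glued k k1 k2 ;
  kb_l : glued (pd3 k) l1 l2 ;
  kb_der : forall s t u, 0 <= s <= 1 -> 0 <= t <= 1 ->
    derivable (fun a => k s t a) u 1 ;
  kb_k1 : C2_box B M k1 ; kb_k2 : C2_box B M k2 ;
  kb_l1 : C2_box B M l1 ; kb_l2 : C2_box B M l2 }.

Lemma kernel_boundP k k1 k2 l1 l2 B : kernel_pieces k k1 k2 l1 l2 ->
  exists M, kernel_bound k k1 k2 l1 l2 B M.
Proof.
move=> [gk gl dk /(C2_boxP B)[M1 h1] /(C2_boxP B)[M2 h2]
  /(C2_boxP B)[M3 h3] /(C2_boxP B)[M4 h4]].
have := c2b_ge0 h1; have := c2b_ge0 h2; have := c2b_ge0 h3; have := c2b_ge0 h4.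
move=> ? ? ? ?.
exists (M1 + M2 + M3 + M4); split; [exact: gk|exact: gl|exact: dk| | | |].
- by apply: C2_boxW h1; lra.
- by apply: C2_boxW h2; lra.
- by apply: C2_boxW h3; lra.
- by apply: C2_boxW h4; lra.
Qed.

Section Bounds.
Variables (k k1 k2 l1 l2 : R -> R -> R -> R) (B M : R).
Hypothesis H : kernel_bound k k1 k2 l1 l2 B M.

Lemma kb_ge0 : 0 <= M. Proof. exact: c2b_ge0 (kb_k1 H). Qed.

Lemma kb_lip : lip_box B M k.
Proof. exact: glued_lip (kb_k H) (kb_k1 H) (kb_k2 H). Qed.

Lemma lb_lip : lip_box B M (pd3 k).
Proof. exact: glued_lip (kb_l H) (kb_l1 H) (kb_l2 H). Qed.

Lemma kb_bnd s t u : box B s t u -> `|k s t u| <= M.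
Proof. exact: (glued_bounded (kb_k H) (kb_k1 H) (kb_k2 H)). Qed.

Lemma lb_bnd s t u : box B s t u -> `|pd3 k s t u| <= M.
Proof. exact: (glued_bounded (kb_l H) (kb_l1 H) (kb_l2 H)). Qed.

Lemma kb_lip3 s t a b : box B s t a -> box B s t b ->
  `|k s t a - k s t b| <= M * `|a - b|.
Proof.
move=> h1 h2; have := kb_lip h1 h2.
by rewrite !subrr normr0 !add0r.
Qed.

Lemma kb_lip1 s s' t a : box B s t a -> box B s' t a ->
  `|k s t a - k s' t a| <= M * `|s - s'|.
Proof.
by move=> h1 h2; have := kb_lip h1 h2; rewrite !subrr normr0 !addr0.
Qed.

Lemma lb_lip1 s s' t a : box B s t a -> box B s' t a ->
  `|pd3 k s t a - pd3 k s' t a| <= M * `|s - s'|.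
Proof.
by move=> h1 h2; have := lb_lip h1 h2; rewrite !subrr normr0 !addr0.
Qed.

Lemma kb_sub_derive s s' t : 0 <= s <= 1 -> 0 <= s' <= 1 -> 0 <= t <= 1 ->
  forall u : R, is_derive u (1 : R) (fun a => k s t a - k s' t a)
    (pd3 k s t u - pd3 k s' t u).
Proof.
move=> hs hs' ht u.
have d r : 0 <= r <= 1 ->
    is_derive u (1 : R) (fun a => k r t a) (pd3 k r t u).
  move=> hr; rewrite /pd3 derive1E; apply: DeriveDef; [exact: (kb_der H)|by []].
have := d _ hs; have := d _ hs' => d1 d2.
exact: is_deriveB.
Qed.

(** Valid across the diagonal too, since [pd3 k] is itself glued and therefore Lipschitz in [s]
    there. *)
Lemma kb_mixed s s' t a b : 0 <= s <= 1 -> 0 <= s' <= 1 -> 0 <= t <= 1 ->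
  - B <= a <= B -> - B <= b <= B ->
  `|k s t a - k s' t a - (k s t b - k s' t b)| <= M * `|s - s'| * `|a - b|.
Proof.
move=> hs hs' ht ha hb; have dd := kb_sub_derive hs hs' ht.
apply: (@lip_of_derive1 _ (fun a => k s t a - k s' t a) (- B) B) => //.
move=> z hz; rewrite derive1E (@derive_val _ _ _ _ _ _ _ (dd z)).
exact: lb_lip1.
Qed.

Lemma kb_taylor3 s t a b : box B s t a -> box B s t b ->
  `|k s t a - k s t b - pd3 k s t b * (a - b)| <= M * `|a - b| ^+ 2.
Proof.
move=> [hs ht ha] [_ _ hb].
apply: (@taylor1_of_lip _ (fun a => k s t a) (- B) B) => //.
- by move=> z; exact: (kb_der H).
- exact: kb_ge0.
- move=> z hz; have := @lb_lip s t z s t b.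
  by rewrite !subrr normr0 !add0r; apply.
Qed.

(* The off-diagonal second difference: the cancellation behind the third
   order of the projection error. *)
Lemma kb_mixed_taylor s s' t t0 a c :
  (t <= s /\ t <= s') /\ (t0 <= s /\ t0 <= s') \/
  (s <= t /\ s' <= t) /\ (s <= t0 /\ s' <= t0) ->
  0 <= s <= 1 -> 0 <= s' <= 1 -> 0 <= t <= 1 -> 0 <= t0 <= 1 ->
  - B <= a <= B -> - B <= c <= B ->
  `|k s t a - k s' t a - (k s t c - k s' t c) -
     (pd3 k s t0 c - pd3 k s' t0 c) * (a - c)| <=
    M * `|s - s'| * (`|t - t0| + `|a - c|) * `|a - c|.
Proof.
move=> side hs hs' ht ht0 ha hc; have dd := kb_sub_derive hs hs' ht.
have M0 := kb_ge0.
have ex : forall z : R, derivable (fun a => k s t a - k s' t a) z 1.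
  by move=> z; case: (dd z).
have [x [hx xc ->]] := mvt_in ex hc ha.
rewrite derive1E (@derive_val _ _ _ _ _ _ _ (dd x)) -mulrBl normrM.
rewrite ler_wpM2r//.
apply: (@le_trans _ _ (M * `|s - s'| * (`|t - t0| + `|x - c|))); last first.
  by rewrite ler_wpM2l ?mulr_ge0// lerD2l.
have [e1 e2] := kb_l H.
have [[s0 s1] [s'0 s'1]] := (andP hs, andP hs').
have [[t0' t1] [t00 t01]] := (andP ht, andP ht0).
case: side => -[[h1 h2] [h3 h4]].
  by rewrite !e1//; apply: (C2_box_mixed (kb_l1 H)).
by rewrite !e2//; apply: (C2_box_mixed (kb_l2 H)).
Qed.

End Bounds.
End Kernel.

(** * Bounded measurable functions *)

Section BoundedMeasurable.
Variable R : realType.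
Notation mu := (@lebesgue_measure R).
Implicit Types (x y g : R -> R) (c : R).

Lemma I01P (t : R) : I01 t <-> 0 <= t <= 1.
Proof. by rewrite /I01/= in_itv. Qed.

Lemma measurable_I01 : measurable (@I01 R).
Proof. exact: measurable_itv. Qed.

Lemma mu_I01 : mu (@I01 R) = 1%:E.
Proof. by rewrite /I01 lebesgue_measure_itv/= lte_fin ltr01 oppr0 adde0. Qed.

Lemma supn_ge x (t : R) : Xsp x -> I01 t -> `|x t| <= supn x.
Proof.
move=> [_ [M hM]] ht; apply: ub_le_sup; last by exists t.
by exists M => _ [s hs <-]; exact: hM.
Qed.

Lemma supn_le x c : (forall t, I01 t -> `|x t| <= c) -> supn x <= c.
Proof.
move=> h; apply: ge_sup; last by move=> _ [s hs <-]; exact: h.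
by exists `|x 0|, 0 => //; apply/I01P; rewrite lexx ler01.
Qed.

Lemma supn_ge0 x : Xsp x -> 0 <= supn x.
Proof.
move=> hx; apply: (le_trans (normr_ge0 (x 0))); apply: supn_ge => //.
by apply/I01P; rewrite lexx ler01.
Qed.

Lemma Xsp_add x y : Xsp x -> Xsp y -> Xsp (fadd x y).
Proof.
move=> [mx [M hM]] [my [N hN]]; split; first exact: measurable_funD.
exists (M + N) => t ht; apply: (le_trans (ler_normD _ _)).
by apply: lerD; [exact: hM|exact: hN].
Qed.

Lemma Xsp_scale c x : Xsp x -> Xsp (fscale c x).
Proof.
move=> [mx [M hM]]; split; first exact: measurable_funM.
exists (`|c| * M) => t ht; rewrite /fscale normrM ler_wpM2l//; exact: hM.
Qed.

(** Linearity is postulated for combinations [a x + y], so differences are brought to that form. *)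
Lemma fsubE x y : fsub x y = fadd (fscale (-1) y) x.
Proof. by apply/funext => t; rewrite /fsub /fadd /fscale; ring. Qed.

Lemma Xsp_sub x y : Xsp x -> Xsp y -> Xsp (fsub x y).
Proof. by move=> hx hy; rewrite fsubE; apply: Xsp_add => //; exact: Xsp_scale. Qed.

Definition lipI c x := forall s t, I01 s -> I01 t -> `|x s - x t| <= c * `|s - t|.

Lemma lipI_continuous c x : lipI c x -> {within @I01 R, continuous x}.
Proof.
move=> h; apply/subspace_continuousP => t It; apply/cvgrPdist_le => e e0.
rewrite near_withinE; near=> s => Is.
apply: (le_trans (h _ _ It Is)).
apply: (@le_trans _ _ ((`|c| + 1) * `|t - s|)).
  by rewrite ler_wpM2r// (le_trans (ler_norm _))// lerDl.
rewrite mulrC -ler_pdivlMr ?ltr_wpDl//.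
near: s; apply: cvgr_dist_le; first exact: cvg_id.
by rewrite divr_gt0 ?ltr_wpDl.
Unshelve. all: by end_near. Qed.

Lemma continuous_Xsp x : {within @I01 R, continuous x} -> Xsp x.
Proof.
move=> cx; split.
  exact: (subspace_continuous_measurable_fun measurable_I01 cx).
have cA : compact (@I01 R) by exact: segment_compact.
have [M0 [_ hM]] := compact_bounded (continuous_compact cx cA).
exists (`|M0| + 1) => t It.
apply: (hM (`|M0| + 1)); first by rewrite (le_lt_trans (ler_norm _))// ltrDl.
by exists t.
Qed.

Lemma lipI_Xsp c x : lipI c x -> Xsp x.
Proof. by move=> /lipI_continuous /continuous_Xsp. Qed.

(** The values of [x] are rounded down to multiples of [1 / (m + 1)]. On each of the countably many
    level sets the composition is continuous in [t], and continuity in [u] carries measurability to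
    the limit. *)
Lemma measurable_comp_cont3 (G : R -> R -> R -> R) (s : R) (D : set R) x :
  measurable D -> cont3 G -> measurable_fun D x ->
  measurable_fun D (fun t => G s t (x t)).
Proof.
move=> mD cG mx.
have cu (t : R) : continuous (fun u => G s t u).
  move=> u; apply: (@continuous_comp _ _ _ (fun u : R => (s, t, u))
    (fun v : R * R * R => G v.1.1 v.1.2 v.2)); last exact: cG.
  by apply: (@cvg_pair _ _ _ _ (nbhs (s, t)) (nbhs u));
    [exact: cvg_cst|exact: cvg_id].
have ct (u : R) : continuous (fun t => G s t u).
  move=> t; apply: (@continuous_comp _ _ _ (fun t : R => (s, t, u))
    (fun v : R * R * R => G v.1.1 v.1.2 v.2)); last exact: cG.
  apply: (@cvg_pair _ _ _ _ (nbhs (s, t)) (nbhs u)); last exact: cvg_cst.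
  by apply: (@cvg_pair _ _ _ _ (nbhs s) (nbhs t));
    [exact: cvg_cst|exact: cvg_id].
pose fl m t : R := (Num.floor (m.+1%:R * x t))%:~R / m.+1%:R.
apply: (@measurable_fun_cvg _ _ _ _ (fun m t => G s t (fl m t))) => //.
  move=> m _ Y mY.
  rewrite (_ : D `&` _ = \bigcup_(z : int)
    ((D `&` x @^-1` `[z%:~R / m.+1%:R, (z + 1)%:~R / m.+1%:R[%classic) `&`
     ((fun t => G s t (z%:~R / m.+1%:R)) @^-1` Y))).
    apply: countable_bigcupT_measurable => [|z]; first exact: countableP.
    apply: measurableI.
      by apply: mx => //; exact: measurable_itv.
    rewrite -[X in measurable X]setTI.
    by apply: (continuous_measurable_fun (ct _)).
  have mp : 0 < m.+1%:R :> R by [].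
  apply/seteqP; split => t.
    move=> [Dt Yt]; exists (Num.floor (m.+1%:R * x t)) => //; split => //.
    split => //; rewrite /= in_itv/= ler_pdivrMr// ltr_pdivlMr//.
    by rewrite [x t * _]mulrC floor_le floorD1_gt.
  move=> [z _ [[Dt xt] Yt]]; split => //=; move: xt; rewrite /= in_itv/=.
  rewrite ler_pdivrMr// ltr_pdivlMr// => h.
  by rewrite /fl (@floor_def _ _ z)// mulrC.
move=> t Dt; apply: (continuous_cvg _ (cu t _)).
apply/cvgrPdist_le => e e0; near=> m.
have mp : 0 < m.+1%:R :> R by [].
rewrite /fl -[X in `|X - _|](@mulfK _ m.+1%:R) ?gt_eqF// -mulrBl normrM.
rewrite (@ger0_norm _ _^-1) ?invr_ge0// ler_pdivrMr// mulrC.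
apply: (@le_trans _ _ 1).
  have := floor_le (m.+1%:R * x t); have := floorD1_gt (m.+1%:R * x t).
  rewrite intrD => h1 h2; rewrite ger0_norm; lra.
rewrite -ler_pdivrMl// mulr1.
near: m; apply: filterS (nbhs_infty_ger e^-1) => m /le_trans; apply.
by rewrite ler_nat.
Unshelve. all: by end_near. Qed.

Lemma Xsp_integrable x (D : set R) : measurable D -> D `<=` @I01 R -> Xsp x ->
  mu.-integrable D (EFin \o x).
Proof.
move=> mD DI [mx [M hM]].
have ix : mu.-integrable (@I01 R) (EFin \o x).
  apply: measurable_bounded_integrable; [exact: measurable_I01| |exact: mx|].
    by apply: (le_lt_trans _ (ltry 1)); rewrite le_eqVlt; apply/orP; left;
      apply/eqP; exact: mu_I01.
  exists M; split; first exact: num_real.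
  by move=> N MN t It; apply: (le_trans (hM _ It)); exact: ltW.
by apply: integrableS ix => //; exact: measurable_I01.
Qed.

Definition int01 x : R := (\int[mu]_(t in @I01 R) x t)%R.

Lemma int01D x y : Xsp x -> Xsp y ->
  int01 (fun t => x t + y t) = int01 x + int01 y.
Proof.
by move=> hx hy; apply: RintegralD; [exact: measurable_I01|
  exact: (Xsp_integrable measurable_I01)..].
Qed.

Lemma int01B x y : Xsp x -> Xsp y ->
  int01 (fun t => x t - y t) = int01 x - int01 y.
Proof.
by move=> hx hy; apply: RintegralB; [exact: measurable_I01|
  exact: (Xsp_integrable measurable_I01)..].
Qed.

Lemma int01Z c x : Xsp x -> int01 (fun t => c * x t) = c * int01 x.
Proof.
by move=> hx; apply: RintegralZl; [exact: measurable_I01|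
  exact: (Xsp_integrable measurable_I01)].
Qed.

Lemma int01_le x y : Xsp x -> Xsp y -> (forall t, I01 t -> x t <= y t) ->
  int01 x <= int01 y.
Proof.
by move=> hx hy h; apply: le_Rintegral => //; [exact: measurable_I01|
  exact: (Xsp_integrable measurable_I01)..].
Qed.

Lemma Xsp_norm x : Xsp x -> Xsp (fun t => `|x t|).
Proof.
move=> [mx [M hM]]; split; first exact: measurableT_comp.
by exists M => t It; rewrite normr_id; exact: hM.
Qed.

Lemma int01_norm x : Xsp x -> `|int01 x| <= int01 (fun t => `|x t|).
Proof.
by move=> hx; apply: le_normr_Rintegral; [exact: measurable_I01|
  exact: (Xsp_integrable measurable_I01)].
Qed.

Lemma int01_cst c : int01 (fun=> c) = c.
Proof.
transitivity (c * fine (mu (@I01 R))); last by rewrite mu_I01 mulr1.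
by apply: Rintegral_cst; exact: measurable_I01.
Qed.

Lemma Xsp_cst c : Xsp (fun=> c : R).
Proof. by split => //; exists `|c|. Qed.

Lemma int01_bound x c : Xsp x -> (forall t, I01 t -> `|x t| <= c) ->
  `|int01 x| <= c.
Proof.
move=> hx h; apply: (le_trans (int01_norm hx)); rewrite -[leRHS]int01_cst.
by apply: int01_le => //; [exact: Xsp_norm|exact: Xsp_cst].
Qed.

End BoundedMeasurable.

(** * Cells and composite rules *)

Section Cells.
Variable R : realType.
Implicit Types (n p m i j : nat) (g v w : R -> R).

Lemma gmu_bounds q : 0 < gmu R q < 1.
Proof.
have s3 : 1 < Num.sqrt (3 : R).
  by rewrite -[ltLHS]sqrtr1 ltr_sqrt; lra.
have h : 0 < 1 / (2 * Num.sqrt (3 : R)) < 1 / 2.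
  rewrite divr_gt0 ?mulr_gt0//=; try lra.
  by rewrite ltr_pdivrMr ?mulr_gt0//; nra.
by rewrite /gmu; case: ifP => _; lra.
Qed.

(** Symmetry of the nodes about the midpoint makes the rule exact on affine functions. *)
Lemma gmu_sum : gmu R 1 + gmu R 2 = 1.
Proof. by rewrite /gmu/=; field; rewrite gt_eqF// sqrtr_gt0; lra. Qed.

Lemma zeta_bounds m i q : (0 < m)%N -> (0 < i)%N ->
  (i.-1)%:R / m%:R < zeta R m i q <= i%:R / m%:R.
Proof.
move=> m0 i0; have [h1 h2] := andP (gmu_bounds q).
have mp : 0 < m%:R :> R by rewrite ltr0n.
rewrite /zeta ltrDl divr_gt0//= -mulrDl ler_pM2r ?invr_gt0//.
by rewrite -[in leRHS](prednK i0) -natr1 lerD2l ltW.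
Qed.

Lemma sum_gauss (F : nat -> R) : \sum_(1 <= q < 3) F q = F 1%N + F 2%N.
Proof. by rewrite big_ltn// big_ltn// big_geq// addr0. Qed.

Lemma cell_bounds n j (t : R) : cell n j t ->
  (j.-1)%:R / n%:R <= t <= j%:R / n%:R.
Proof.
move=> [_ [[/ltW ->//|[-> ->]] ->]]; by rewrite mul0r lexx.
Qed.

Lemma cell_I01 n j (t : R) : cell n j t -> I01 t.
Proof.
move=> c; have /andP[h1 h2] := cell_bounds c.
have [/andP[j0 jn] _] := c.
have np : 0 < n%:R :> R by rewrite ltr0n (leq_trans j0).
apply/I01P; rewrite (le_trans _ h1) ?divr_ge0//=.
by rewrite (le_trans h2)// ler_pdivrMr// mul1r ler_nat.
Qed.

Lemma cell_diam n j (s t : R) : cell n j s -> cell n j t -> `|s - t| <= 1 / n%:R.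
Proof.
move=> cs ct; have /andP[h1 h2] := cell_bounds cs; have /andP[h3 h4] := cell_bounds ct.
have [/andP[j0 jn] _] := cs.
have e : j%:R / n%:R = (j.-1)%:R / n%:R + 1 / n%:R :> R.
  by rewrite -[in LHS](prednK j0) -natr1 mulrDl.
by rewrite ler_norml; lra.
Qed.

Lemma cell_exists n (t : R) : (0 < n)%N -> I01 t -> exists j, cell n j t.
Proof.
move=> n0 /I01P /andP[t0 t1].
have np : 0 < n%:R :> R by rewrite ltr0n.
have ex : exists j, (0 < j)%N && (t <= j%:R / n%:R).
  by exists n; rewrite n0 divff ?gt_eqF.
case: (ex_minnP ex) => j /andP[j0 tj] jmin.
exists j; split; first by rewrite j0 jmin// n0 divff ?gt_eqF.
split => //; have [j1|j1] := leqP j 1.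
  have -> : j = 1%N by apply/eqP; rewrite eqn_leq j1.
  move: t0; rewrite le_eqVlt => /predU1P[<-|t0]; first by right.
  by left; rewrite mul0r.
left; rewrite ltNge; apply/negP => tj'.
have hj : (0 < j.-1)%N by rewrite -ltnS prednK.
have := jmin j.-1; rewrite hj tj' => /(_ isT).
by rewrite -{1}(prednK j0) ltnn.
Qed.

Lemma zeta_cell n p j nu q : (0 < p)%N -> (1 <= j <= n)%N -> (1 <= nu <= p)%N ->
  cell n j (zeta R (n * p) (j.-1 * p + nu) q).
Proof.
move=> p0 /andP[j0 jn] /andP[nu0 nup].
have n0 : (0 < n)%N by apply: leq_trans jn.
have np : 0 < n%:R :> R by rewrite ltr0n.
have pp : 0 < p%:R :> R by rewrite ltr0n.
have np0 : (0 < n * p)%N by rewrite muln_gt0 n0.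
have i0 : (0 < j.-1 * p + nu)%N by rewrite addn_gt0 nu0 orbT.
have /andP[z1 z2] := zeta_bounds q np0 i0.
split; first by rewrite j0.
have e : forall k, k%:R / n%:R = (k * p)%:R / (n * p)%:R :> R.
  by move=> k; rewrite !natrM; field; rewrite !gt_eqF.
have mp : 0 < (n * p)%:R :> R by rewrite ltr0n muln_gt0 n0.
split.
  left; apply: (le_lt_trans _ z1).
  rewrite e ler_pM2r ?invr_gt0// ler_nat.
  by rewrite -(prednK nu0) addnS/= leq_addr.
apply: (le_trans z2).
rewrite e ler_pM2r ?invr_gt0// ler_nat.
by rewrite -[in leqRHS](prednK j0) mulSn addnC leq_add2r.
Qed.

Lemma sum_mul_blocks (F : nat -> R) n p :
  \sum_(1 <= i < (n * p).+1) F i =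
  \sum_(1 <= j < n.+1) \sum_(1 <= nu < p.+1) F (j.-1 * p + nu)%N.
Proof.
elim: n => [|n IH]; first by rewrite mul0n !big_geq.
rewrite [RHS]big_nat_recr//= -IH (@big_cat_nat _ _ _ (n * p).+1)//=; last first.
  by rewrite ltnS leq_mul2r leqnSn orbT.
congr (_ + _); rewrite !big_add1/= mulSn.
rewrite -{1}[(n * p)%N]add0n [(p + _)%N]addnC -{1}[p in (_ + p)%N]addn0.
rewrite big_addn addn0 addnC addnK.
by apply: eq_bigr => i _; rewrite addnS addnC.
Qed.

Lemma qavgD n p j v w :
  qavg n p j (fun t => v t + w t) = qavg n p j v + qavg n p j w.
Proof.
rewrite /qavg -mulrDr -big_split/=; congr (_ * _); apply: eq_bigr => nu _.
by rewrite -big_split/=; apply: eq_bigr => q _; rewrite mulrDr.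
Qed.

Lemma qavgZ n p j (a : R) v :
  qavg n p j (fun t => a * v t) = a * qavg n p j v.
Proof.
rewrite /qavg [RHS]mulrCA [in RHS]mulr_sumr; congr (_ * _); apply: eq_bigr => nu _.
by rewrite mulr_sumr; apply: eq_bigr => q _; rewrite mulrCA.
Qed.

Lemma qavgB n p j v w :
  qavg n p j (fun t => v t - w t) = qavg n p j v - qavg n p j w.
Proof.
transitivity (qavg n p j (fun t => v t + -1 * w t)).
  by congr qavg; apply/funext => t; rewrite mulN1r.
by rewrite qavgD qavgZ mulN1r.
Qed.

Lemma qavg_le n p j v (c : R) : (0 < p)%N -> (1 <= j <= n)%N ->
  (forall t, cell n j t -> v t <= c) -> qavg n p j v <= c.
Proof.
move=> p0 hj h; have pp : 0 < p%:R :> R by rewrite ltr0n.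
rewrite /qavg mulrC -ler_pdivlMr ?divr_gt0// div1r invrK.
have -> : c * p%:R = \sum_(1 <= nu < p.+1) c.
  by rewrite sumr_const_nat subn1 mulr_natr.
apply: ler_sum_nat => nu hnu; rewrite sum_gauss -mulrDr /gw.
have hz q := h _ (@zeta_cell n p j nu q p0 hj hnu).
have := hz 1%N; have := hz 2%N; lra.
Qed.

Lemma qavg_bound n p j v (c : R) : (0 < p)%N -> (1 <= j <= n)%N ->
  (forall t, cell n j t -> `|v t| <= c) -> `|qavg n p j v| <= c.
Proof.
move=> p0 hj h; rewrite ler_norml; apply/andP; split; last first.
  by apply: qavg_le => // t /h; rewrite ler_norml => /andP[].
rewrite lerNl -mulN1r -qavgZ; apply: qavg_le => // t /h.
by rewrite mulN1r ler_norml lerNl => /andP[].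
Qed.

Lemma qavg_cst n p j (c : R) : (0 < p)%N -> qavg n p j (fun=> c) = c.
Proof.
move=> p0; have pp : 0 < p%:R :> R by rewrite ltr0n.
rewrite /qavg (eq_bigr (fun=> c)); last by move=> nu _; rewrite sum_gauss /gw; lra.
by rewrite sumr_const_nat subn1/= -mulr_natr; field; rewrite gt_eqF.
Qed.

Lemma qavg_dist n p j v (c d : R) : (0 < p)%N -> (1 <= j <= n)%N ->
  (forall t, cell n j t -> `|v t - c| <= d) -> `|qavg n p j v - c| <= d.
Proof.
by move=> p0 hj h; rewrite -{1}(@qavg_cst n p j c p0) -qavgB; exact: qavg_bound.
Qed.

Definition nys n p g : R :=
  1 / (n * p)%:R * \sum_(1 <= i < (n * p).+1) \sum_(1 <= q < 3)
    gw R * g (zeta R (n * p) i q).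

(** As [m = n p], the fine sum over one coarse cell is, up to the weight [1 / n], the value of the
    projection there. Estimates of the Nystrom operator thus reduce to single coarse cells. *)
Lemma nysE n p g : (0 < n)%N -> (0 < p)%N ->
  nys n p g = 1 / n%:R * \sum_(1 <= j < n.+1) qavg n p j g.
Proof.
move=> n0 p0; rewrite /nys sum_mul_blocks /qavg -mulr_sumr mulrA; congr (_ * _).
by rewrite natrM; field; rewrite !gt_eqF ?ltr0n.
Qed.

Lemma nysB n p v w : nys n p (fun t => v t - w t) = nys n p v - nys n p w.
Proof.
rewrite /nys -mulrBr -sumrB; congr (_ * _); apply: eq_bigr => nu _.
by rewrite -sumrB; apply: eq_bigr => q _; rewrite mulrBr.
Qed.

Lemma nysZ n p (a : R) v : nys n p (fun t => a * v t) = a * nys n p v.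
Proof.
rewrite /nys [RHS]mulrCA [in RHS]mulr_sumr; congr (_ * _); apply: eq_bigr => nu _.
by rewrite mulr_sumr; apply: eq_bigr => q _; rewrite mulrCA.
Qed.

Lemma nys_cells n p g (c : nat -> R) : (0 < n)%N -> (0 < p)%N ->
  (forall j, (1 <= j <= n)%N -> `|qavg n p j g| <= c j) ->
  `|nys n p g| <= 1 / n%:R * \sum_(1 <= j < n.+1) c j.
Proof.
move=> n0 p0 h; rewrite nysE// normrM ger0_norm ?divr_ge0//.
rewrite ler_wpM2l ?divr_ge0//; apply: (le_trans (ler_norm_sum _ _ _)).
by apply: ler_sum_nat => j hj; exact: h.
Qed.

Lemma mean_cst n (c : R) : (0 < n)%N -> 1 / n%:R * \sum_(1 <= j < n.+1) c = c.
Proof.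
move=> n0; rewrite sumr_const_nat subn1/= -mulr_natr.
by field; rewrite gt_eqF ?ltr0n.
Qed.

Lemma nys_bound n p g (c : R) : (0 < n)%N -> (0 < p)%N ->
  (forall t, I01 t -> `|g t| <= c) -> `|nys n p g| <= c.
Proof.
move=> n0 p0 h; rewrite -[leRHS](mean_cst c n0).
by apply: nys_cells => // j hj; apply: qavg_bound => // t /cell_I01; exact: h.
Qed.

End Cells.

(** * Quadrature errors *)

Section Quadrature.
Variable R : realType.
Notation mu := (@lebesgue_measure R).
Implicit Types (a b c : R) (g : R -> R).

Lemma lipI_affine (A be c : R) : lipI `|be| (fun t => A + be * (t - c)).
Proof.
move=> s t _ _; have -> : A + be * (s - c) - (A + be * (t - c)) = be * (s - t) by ring.
by rewrite normrM.
Qed.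

Lemma Rintegral_affine (a b A be : R) : a < b ->
  (\int[mu]_(t in `[a, b]) (A + be * (t - (a + b) / 2)))%R = A * (b - a).
Proof.
move=> ab; set c := (a + b) / 2.
pose F (t : R) : R := A * t + be / 2 * (t - c) ^+ 2.
have dF (t : R) : is_derive t (1 : R) F (A + be * (t - c)).
  by rewrite /F; apply: is_derive_eq; rewrite /GRing.scale/=; field.
have cF (t : R) : F x @[x --> t] --> F t.
  by apply/differentiable_continuous/derivable1_diffP; case: (dF t).
have cf : continuous (fun t : R => A + be * (t - c)).
  move=> t; apply: cvgD; first exact: cvg_cst.
  apply: cvgM; first exact: cvg_cst.
  by apply: cvgB; [exact: cvg_id|exact: cvg_cst].
rewrite /Rintegral (@continuous_FTC2 _ _ F _ _ ab).
- by rewrite -EFinB/= /F /c; field.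
- exact: continuous_subspaceT.
- split; [by move=> t _; case: (dF t)|exact/cvg_at_right_filter/cF|
    exact/cvg_at_left_filter/cF].
- by move=> t _; rewrite derive1E (@derive_val _ _ _ _ _ _ _ (dF t)).
Qed.

Lemma itv_sub_I01 a b : 0 <= a -> b <= 1 -> `[a, b]%classic `<=` @I01 R.
Proof.
move=> a0 b1 t /=; rewrite in_itv/= => /andP[h1 h2]; apply/I01P.
by rewrite (le_trans a0 h1) (le_trans h2 b1).
Qed.

Lemma cell_quadrature a b g (A be rho : R) : 0 <= a -> a < b -> b <= 1 -> Xsp g ->
  (forall t, a <= t <= b -> `|g t - A - be * (t - (a + b) / 2)| <= rho) ->
  `|(\int[mu]_(t in `[a, b]) g t)%R - A * (b - a)| <= rho * (b - a).
Proof.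
move=> a0 ab b1 hg h; rewrite -(@Rintegral_affine a b A be ab).
have mI : measurable (`[a, b]%classic : set R) by exact: measurable_itv.
have sI := itv_sub_I01 a0 b1.
have hA : Xsp (fun t => A + be * (t - (a + b) / 2)) := lipI_Xsp (@lipI_affine _ _ _).
have hgA : Xsp (fun t => g t - (A + be * (t - (a + b) / 2))) := Xsp_sub hg hA.
rewrite -RintegralB; [|exact: mI|exact: (Xsp_integrable mI)..].
apply: (@le_trans _ _ (\int[mu]_(t in `[a, b])
    `|g t - (A + be * (t - (a + b) / 2))|)%R).
  by apply: le_normr_Rintegral; [exact: mI|exact: (Xsp_integrable mI)].
have -> : rho * (b - a) = (\int[mu]_(t in `[a, b]) rho)%R.
  transitivity (rho * fine (mu `[a, b]%classic)).
    by rewrite lebesgue_measure_itv/= lte_fin ab.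
  by symmetry; apply: Rintegral_cst; exact: mI.
apply: le_Rintegral; [exact: mI|exact: (Xsp_integrable mI sI (Xsp_norm hgA))|
  exact: (Xsp_integrable mI sI (Xsp_cst _))|].
move=> t /=; rewrite in_itv/= => /h; rewrite opprD addrA; exact.
Qed.

Lemma int01_split (m : nat) g : (0 < m)%N -> Xsp g ->
  int01 g = \sum_(1 <= i < m.+1)
    (\int[mu]_(t in `[(i.-1)%:R / m%:R, i%:R / m%:R]) g t)%R.
Proof.
move=> m0 hg; have mp : 0 < m%:R :> R by rewrite ltr0n.
suff h k : (k <= m)%N -> (\int[mu]_(t in `[0%R, (k%:R / m%:R)%R]) g t)%R =
    \sum_(1 <= i < k.+1)
    (\int[mu]_(t in `[(i.-1)%:R / m%:R, i%:R / m%:R]) g t)%R.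
  by rewrite -h// divff ?gt_eqF.
elim: k => [_|k IH km].
  by rewrite big_geq// mul0r set_itv1 Rintegral_set1.
rewrite big_nat_recr//= -IH ?(ltnW km)//.
have le1 i : (i <= m)%N -> i%:R / m%:R <= 1 :> R.
  by move=> im; rewrite ler_pdivrMr// mul1r ler_nat.
have ge0 i : 0 <= i%:R / m%:R :> R by rewrite divr_ge0.
have lek : k%:R / m%:R <= k.+1%:R / m%:R :> R.
  by rewrite ler_pM2r ?invr_gt0// ler_nat.
have mI (u v : R) : measurable (`[u, v]%classic : set R) by exact: measurable_itv.
have mJ : measurable (`]k%:R / m%:R, k.+1%:R / m%:R]%classic : set R).
  exact: measurable_itv.
rewrite -(@Rintegral_itv_obnd_cbnd R (k%:R / m%:R)); last first.
  apply: (Xsp_integrable mJ) => // t /=.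
  rewrite in_itv/= => /andP[h1 h2]; apply/I01P.
  by rewrite (le_trans (ge0 k) (ltW h1)) (le_trans h2 (le1 _ km)).
rewrite -(@Rintegral_itvB R g (BLeft 0) (BRight (k.+1%:R / m%:R)) (k%:R / m%:R)).
- by rewrite addrCA subrr addr0.
- by apply: (Xsp_integrable (mI _ _)) => //; apply: itv_sub_I01 => //; exact: le1.
- by rewrite bnd_simp.
- by rewrite bnd_simp.
Qed.

(** The slope [be] drops out of the integral because the affine part is centred at the midpoint, and
    out of the rule because the nodes are symmetric. The factor 2 adds the errors of integral and
    rule. Letting [rho] depend on the cell leaves room for a worse bound at a kink. *)
Lemma nys_quadrature (n p : nat) g (rho : nat -> R) : (0 < n)%N -> (0 < p)%N ->
  let m := (n * p)%N in Xsp g ->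
  (forall i, (1 <= i <= m)%N ->
    let a := (i.-1)%:R / m%:R in let b := i%:R / m%:R in
    exists A be, forall t, a <= t <= b ->
      `|g t - A - be * (t - (a + b) / 2)| <= rho i) ->
  `|int01 g - nys n p g| <= 2 / m%:R * \sum_(1 <= i < m.+1) rho i.
Proof.
move=> n0 p0 m hg h.
have m0 : (0 < m)%N by rewrite muln_gt0 n0.
have mp : 0 < m%:R :> R by rewrite ltr0n.
rewrite (int01_split m0 hg) /nys -/m mulr_sumr -sumrB.
rewrite mulr_sumr; apply: (le_trans (ler_norm_sum _ _ _)).
apply: ler_sum_nat => i hi; have [i0 im] := andP hi.
have [A [be hA]] := h i hi.
set a := (i.-1)%:R / m%:R in hA *; set b := i%:R / m%:R in hA *.
have eb : b = a + 1 / m%:R by rewrite /b -(prednK i0) -natr1 mulrDl.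
have ab : a < b by rewrite eb ltrDl divr_gt0.
have a0 : 0 <= a by rewrite divr_ge0.
have b1 : b <= 1 by rewrite ler_pdivrMr// mul1r ler_nat.
have Q := cell_quadrature a0 ab b1 hg hA.
have z q : a <= zeta R m i q <= b.
  by have /andP[/ltW -> ->] := @zeta_bounds R m i q m0 i0.
have zs : zeta R m i 1 + zeta R m i 2 = a + b.
  have e : gmu R 1 = 1 - gmu R 2 by rewrite -(gmu_sum R) addrK.
  by rewrite /zeta -/a e eb; ring.
have h1 := hA _ (z 1%N); have h2 := hA _ (z 2%N).
rewrite sum_gauss /gw.
have Q2 : `|A - (1 / 2 * g (zeta R m i 1) + 1 / 2 * g (zeta R m i 2))| <= rho i.
  have -> : A - (1 / 2 * g (zeta R m i 1) + 1 / 2 * g (zeta R m i 2)) =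
    - (1 / 2) * ((g (zeta R m i 1) - A - be * (zeta R m i 1 - (a + b) / 2)) +
      (g (zeta R m i 2) - A - be * (zeta R m i 2 - (a + b) / 2))).
    by rewrite -zs; field.
  rewrite normrM normrN (@ger0_norm _ (1 / 2)); last by lra.
  have := ler_normD (g (zeta R m i 1) - A - be * (zeta R m i 1 - (a + b) / 2))
      (g (zeta R m i 2) - A - be * (zeta R m i 2 - (a + b) / 2)).
  by lra.
have -> : forall I G : R, I - 1 / m%:R * G = (I - A * (b - a)) + 1 / m%:R * (A - G).
  by move=> I G; rewrite eb; ring.
apply: (le_trans (ler_normD _ _)).
rewrite normrM (@ger0_norm _ (1 / m%:R)) ?divr_ge0//.
have -> : 2 / m%:R * rho i = rho i * (b - a) + 1 / m%:R * rho i.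
  by rewrite eb; ring.
by apply: lerD => //; rewrite ler_wpM2l ?divr_ge0.
Qed.

Lemma sum_cell_indicator (m : nat) (s : R) :
  \sum_(1 <= i < m.+1) (if (i.-1)%:R / m%:R < s <= i%:R / m%:R then 1 else 0)
    <= 1 :> R.
Proof.
(* Strengthened for the induction: the partial sum stays zero until the cells reach [s]. Half-open
   cells prevent an endpoint from being counted twice. *)
have h k : \sum_(1 <= i < k.+1)
   (if (i.-1)%:R / m%:R < s <= i%:R / m%:R then 1 else 0)
    <= (if s <= k%:R / m%:R then 1 else 0) :> R.
  elim: k => [|k IH]; first by rewrite big_geq//; case: ifP.
  rewrite big_nat_recr//= ltNge.
  have hk : k%:R / m%:R <= k.+1%:R / m%:R :> R.
    by rewrite ler_wpM2r ?invr_ge0// ler_nat.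
  case: (boolP (s <= k%:R / m%:R)) IH => [sk|sk] IH.
    by rewrite /= addr0 (le_trans sk hk).
  by rewrite -[leRHS]add0r lerD.
by apply: (le_trans (h m)); case: ifP.
Qed.

(** The rate 1/(np) is deliberately weakened to 1/n, which suffices for the limit arguments and is
    uniform in [p]. *)
Lemma nys_cvg (n p : nat) g (c : R) : (0 < n)%N -> (0 < p)%N -> 0 <= c ->
  lipI c g -> `|int01 g - nys n p g| <= 2 * c / n%:R.
Proof.
move=> n0 p0 c0 hg; have m0 : (0 < n * p)%N by rewrite muln_gt0 n0.
have mp : 0 < (n * p)%:R :> R by rewrite ltr0n.
apply: (le_trans (@nys_quadrature n p g (fun=> c / (n * p)%:R) n0 p0 (lipI_Xsp hg) _)).
  move=> i /andP[i0 im] a b.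
  have eb : b = a + 1 / (n * p)%:R by rewrite /b -(prednK i0) -natr1 mulrDl.
  have a0 : 0 <= a by rewrite divr_ge0.
  have b1 : b <= 1 by rewrite ler_pdivrMr// mul1r ler_nat.
  exists (g a), 0 => t ht; rewrite mul0r subr0.
  apply: (le_trans (hg _ _ _ _)); try by apply/I01P; lra.
  rewrite ler_wpM2l// ger0_norm; last by lra.
  by move: eb; rewrite div1r; lra.
rewrite sumr_const_nat subn1/= -[X in _ * X]mulr_natr.
have -> : 2 / (n * p)%:R * (c / (n * p)%:R * (n * p)%:R) = 2 * c / (n * p)%:R :> R.
  by move: mp; move: ((n * p)%:R : R) => M M0; field; rewrite gt_eqF.
rewrite ler_wpM2l ?mulr_ge0// lef_pV2 ?posrE ?ltr0n// ler_nat.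
by rewrite leq_pmulr.
Qed.

End Quadrature.

(** * Compactness of equi-Lipschitz sequences *)

Section Compactness.
Variable R : realType.
Implicit Types (v : nat -> R -> R) (c B : R).

Lemma bounded_ultra_cvg (U : set_system nat) (a : nat -> R) B :
  UltraFilter U -> (forall k, `|a k| <= B) -> exists l : R, a @ U --> l.
Proof.
move=> FU hB.
have aU : (a @ U) `[- B, B]%classic.
  apply: (@filterS _ U _ setT); last exact: filterT.
  by move=> k _ /=; rewrite in_itv/= -ler_norml.
have [l [_ cl]] := @segment_compact R (- B) B (a @ U) _ aU.
exists l => V nV; have [//|Uc] := in_ultra_setVsetC (a @^-1` V) FU.
by have [x [xV Vx]] := cl (~` V) V Uc nV.
Qed.

(** Arzela-Ascoli along an ultrafilter containing all tails: limits exist at every point at once, so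
    no diagonal subsequence is extracted. The common Lipschitz constant then upgrades closeness on a
    finite grid to uniform closeness. *)
Lemma lipI_cluster v c B : 0 <= c -> (forall k, lipI c (v k)) ->
  (forall k t, I01 t -> `|v k t| <= B) ->
  exists y, [/\ lipI c y, forall t, I01 t -> `|y t| <= B &
    forall e, 0 < e -> forall N : nat, exists2 k, (N <= k)%N &
      forall t, I01 t -> `|v k t - y t| <= e].
Proof.
move=> c0 lv bv; have [U [FU sU]] := ultraFilterLemma (eventually_filter).
have /choice[y hy] : forall t : R, exists l : R, I01 t -> v ^~ t @ U --> l.
  move=> t; have [It|nIt] := pselect (I01 t); last by exists 0.
  by have [l hl] := bounded_ultra_cvg FU (fun k => bv k t It); exists l.
have near_y t e : I01 t -> 0 < e -> \forall k \near U, `|v k t - y t| <= e.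
  move=> It e0; have /cvgrPdist_le /(_ e e0) := hy t It.
  by apply: filterS => k; rewrite distrC.
have ly : lipI c y.
  move=> s t Is It; apply/ler_addgt0Pr => e e0; have e2 : 0 < e / 2 by lra.
  have [k [h1 h2]] := filter_ex (filterI (near_y s _ Is e2) (near_y t _ It e2)).
  have := lv k s t Is It.
  have -> : y s - y t = (v k s - v k t) + ((y s - v k s) + (v k t - y t)) by ring.
  move=> h3; apply: (le_trans (ler_normD _ _)); apply: lerD => //.
  apply: (le_trans (ler_normD _ _)); rewrite [`|y s - _|]distrC.
  by move: h1 h2 => /=; lra.
exists y; split => //.
  move=> t It; apply/ler_addgt0Pr => e e0.
  have [k /= h1] := filter_ex (near_y t _ It e0).
  have -> : y t = v k t - (v k t - y t) by ring.
  by apply: (le_trans (ler_normB _ _)); apply: lerD => //; exact: bv.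
move=> e e0 N.
(* A grid of spacing [1 / r.+1] costs at most [e / 3] for [v k] and for [y] each; closeness at the
   grid points takes the last third. *)
pose r := Num.bound (3 * c / e).
have r0 : (0 < r.+1)%N by [].
have rp : 0 < r.+1%:R :> R by [].
have hr : c * (1 / r.+1%:R) <= e / 3.
  have : 3 * c / e < r.+1%:R.
    apply: (@lt_le_trans _ _ r%:R); last by rewrite ler_nat.
    apply: le_lt_trans (archi_boundP _); first exact: lexx.
    by rewrite divr_ge0 ?mulr_ge0// ltW.
  rewrite ltr_pdivrMr// => h; rewrite mul1r ler_pdivrMr//; lra.
have e3 : 0 < e / 3 by lra.
have Ip (i : 'I_r.+2) : I01 (i%:R / r.+1%:R : R).
  by apply/I01P; rewrite divr_ge0//= ler_pdivrMr// mul1r ler_nat -ltnS.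
have Uk : U [set k | (N <= k)%N] by apply: sU; exact: nbhs_infty_ge.
have [k [/= Nk hk]] := filter_ex (filterI Uk
   (filter_forall _ (fun i : 'I_r.+2 => near_y _ _ (Ip i) e3))).
exists k => // t It; have [j cj] := cell_exists r0 It.
have [/andP[j0 jr] _] := cj.
have jr' : (j < r.+2)%N by rewrite ltnS.
have := hk (Ordinal jr') => /= hj.
have cj' : cell r.+1 j (j%:R / r.+1%:R : R).
  split; first by rewrite j0.
  by split => //; left; rewrite ltr_pM2r ?invr_gt0// ltr_nat prednK.
have Ij := cell_I01 cj'; have d := cell_diam cj cj'.
set x := j%:R / r.+1%:R in hj cj' Ij d.
have h1 : `|v k t - v k x| <= e / 3.
  by apply: (le_trans (lv k t x It Ij)); apply: le_trans hr; rewrite ler_wpM2l.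
have h2 : `|y x - y t| <= e / 3.
  rewrite distrC; apply: (le_trans (ly t x It Ij)); apply: le_trans hr.
  by rewrite ler_wpM2l.
have -> : v k t - y t = (v k t - v k x) + ((v k x - y x) + (y x - y t)) by ring.
apply: (le_trans (ler_normD _ _)).
apply: (le_trans (lerD (lexx _) (ler_normD _ _))).
by lra.
Qed.

End Compactness.

(** * Measurability of glued kernels and integrals of indicators *)

Section IntegralOperator.
Variable R : realType.
Notation mu := (@lebesgue_measure R).
Implicit Types (k g : R -> R -> R -> R) (s t u B M : R) (x : R -> R).

Lemma measurable_if_cont3 g1 g2 s x : cont3 g1 -> cont3 g2 ->
  measurable_fun (@I01 R) x ->
  measurable_fun (@I01 R) (fun t => if t <= s then g1 s t (x t) else g2 s t (x t)).
Proof.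
move=> c1 c2 mx; have mI := @measurable_I01 R.
have mle : measurable_fun (@I01 R) (fun t : R => t <= s).
  by apply: measurable_fun_ler; [exact: measurable_id|exact: measurable_cst].
apply: measurable_fun_if => //.
  apply: (measurable_funS mI); first exact: subIsetl.
  exact: measurable_comp_cont3.
apply: (measurable_funS mI); first exact: subIsetl.
exact: measurable_comp_cont3.
Qed.

Lemma glued_Xsp k g1 g2 s x M : cont3 g1 -> cont3 g2 -> glued k g1 g2 ->
  0 <= s <= 1 -> measurable_fun (@I01 R) x ->
  (forall t, I01 t -> `|k s t (x t)| <= M) -> Xsp (fun t => k s t (x t)).
Proof.
move=> c1 c2 [e1 e2] /andP[s0 s1] mx hM; split; last by exists M.
apply: eq_measurable_fun (measurable_if_cont3 s c1 c2 mx) => t /set_mem /I01P /andP[t0 t1].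
by case: (leP t s) => ts; [rewrite e1|rewrite e2// ltW].
Qed.

Lemma int01_indic a b : 0 <= a -> a <= b -> b <= 1 ->
  int01 (\1_(`[a, b]%classic) : R -> R) = b - a.
Proof.
move=> a0 ab b1; have mI : measurable (`[a, b]%classic : set R).
  exact: measurable_itv.
rewrite /int01 /Rintegral.
have -> : (\int[mu]_(t in @I01 R) (\1_(`[a, b]%classic) t)%:E)%E
    = mu (`[a, b]%classic `&` @I01 R).
  by apply: integral_indic => //; exact: measurable_I01.
rewrite (setIidl (itv_sub_I01 a0 b1)) lebesgue_measure_itv/= lte_fin.
by case: ltgtP ab => // ->; rewrite subrr.
Qed.

Lemma Xsp_indic a b : Xsp (\1_(`[a, b]%classic) : R -> R).
Proof.
split; last by exists 1 => t _; rewrite indicE; case: (_ \in _); rewrite ?normr1 ?normr0.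
by apply: measurable_funTS; apply: measurable_indic; exact: measurable_itv.
Qed.

End IntegralOperator.

(** * Regularity of the solution *)

Section Regularity.
Variable R : realType.
Implicit Types (s t u B M : R) (x phi f : R -> R).

Definition bddI B x := forall t : R, I01 t -> - B <= x t <= B.

(* All of the smoothness of phi that is used. *)
Definition regular L T x := lipI L x /\
  forall c : R, I01 c -> exists be, forall s, I01 s ->
    `|x s - x c - be * (s - c)| <= T * `|s - c| ^+ 2.

Lemma regular_add L T L' T' x y : regular L T x -> regular L' T' y ->
  regular (L + L') (T + T') (fun t => x t + y t).
Proof.
move=> [l1 r1] [l2 r2]; split.
  move=> s t Is It; have -> : x s + y s - (x t + y t) = (x s - x t) + (y s - y t) by ring.
  apply: (le_trans (ler_normD _ _)); rewrite mulrDl.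
  by apply: lerD; [exact: l1|exact: l2].
move=> c Ic; have [b1 h1] := r1 c Ic; have [b2 h2] := r2 c Ic.
exists (b1 + b2) => s Is.
have -> : x s + y s - (x c + y c) - (b1 + b2) * (s - c) =
  (x s - x c - b1 * (s - c)) + (y s - y c - b2 * (s - c)) by ring.
apply: (le_trans (ler_normD _ _)); rewrite mulrDl.
by apply: lerD; [exact: h1|exact: h2].
Qed.

Lemma regular_eqI L T x y : eqI x y -> regular L T x -> regular L T y.
Proof.
move=> e [l r]; split; first by move=> s t Is It; rewrite -!e//; exact: l.
by move=> c Ic; have [b h] := r c Ic; exists b => s Is; rewrite -!e//; exact: h.
Qed.

Lemma C2_01_regular f : C2_01 f -> exists2 M, 0 <= M & regular M M f.
Proof.
move=> [g [dg [ddg [cddg fg]]]].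
have cont_bnd (h : R -> R) : continuous h ->
    exists2 N, 0 <= N & forall t, 0 <= t <= 1 -> `|h t| <= N.
  move=> ch; have [_ [N hN]] : Xsp h.
    by apply: continuous_Xsp; exact: continuous_subspaceT.
  exists N; last by move=> t /I01P; exact: hN.
  by apply: le_trans (hN 0 _) => //; apply/I01P; rewrite lexx ler01.
have [N1 N10 h1] : exists2 N, 0 <= N & forall t, 0 <= t <= 1 -> `|derive1 g t| <= N.
  apply: cont_bnd => t.
  exact/differentiable_continuous/derivable1_diffP/ddg.
have [N2 N20 h2] := cont_bnd _ cddg.
exists (N1 + N2); first by rewrite addr_ge0.
apply: (@regular_eqI _ _ g); first by move=> t It; rewrite fg.
split.
  move=> s t /I01P Is /I01P It.
  apply: (le_trans (lip_of_derive1 dg h1 Is It)).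
  by rewrite ler_wpM2r// lerDl.
move=> c /I01P Ic; exists (derive1 g c) => s /I01P Is.
have hz z : 0 <= z <= 1 -> `|derive1 g z - derive1 g c| <= N2 * `|z - c|.
  by move=> Iz; exact: (lip_of_derive1 ddg h2 Iz Ic).
apply: (le_trans (taylor1_of_lip dg N20 hz Ic Is)).
by rewrite ler_wpM2r ?exprn_ge0// lerDr.
Qed.

Variables (k k1 k2 l1 l2 : R -> R -> R -> R) (B M : R).
Hypothesis P : kernel_pieces k k1 k2 l1 l2.
Hypothesis H : kernel_bound k k1 k2 l1 l2 B M.

Lemma kernel_Xsp s x : I01 s -> Xsp x -> bddI B x -> Xsp (fun t => k s t (x t)).
Proof.
move=> /I01P Is [mx _] bx; have [[c1 _] _] := kp_k1 P; have [[c2 _] _] := kp_k2 P.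
apply: (@glued_Xsp _ k k1 k2 s x M c1 c2 (kp_k P) Is mx) => t It.
by apply: (kb_bnd H); split; [exact: Is|exact/I01P|exact: bx].
Qed.

Lemma dkernel_Xsp s x : I01 s -> Xsp x -> bddI B x ->
  Xsp (fun t => pd3 k s t (x t)).
Proof.
move=> /I01P Is [mx _] bx; have [[c1 _] _] := kp_l1 P; have [[c2 _] _] := kp_l2 P.
apply: (@glued_Xsp _ (pd3 k) l1 l2 s x M c1 c2 (kp_l P) Is mx) => t It.
by apply: (lb_bnd H); split; [exact: Is|exact/I01P|exact: bx].
Qed.

Lemma box_of s t u : I01 s -> I01 t -> - B <= u <= B -> box B s t u.
Proof. by move=> /I01P ? /I01P ?. Qed.

Lemma Kop_lip x : Xsp x -> bddI B x -> lipI M (Kop k x).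
Proof.
move=> hx bx s t Is It; rewrite /Kop -!/(int01 _) -int01B; [|exact: kernel_Xsp..].
apply: int01_bound; first by apply: Xsp_sub; exact: kernel_Xsp.
by move=> r Ir; apply: (kb_lip1 H); apply: box_of => //; exact: bx.
Qed.

(** The slope at [c] integrates [pd1] of the piece active at [t]. Off the interval between [s] and
    [c] the Taylor error is [M |s - c|^2]; on it a further [2 M |s - c|] appears, but the interval
    has length |s - c|, whence [3 M]. Boundedness and measurability of [x] suffice, so phi = f + K
    phi gains this regularity. *)
Lemma Kop_regular x : Xsp x -> bddI B x -> regular M (3 * M) (Kop k x).
Proof.
move=> hx bx; split; first exact: Kop_lip.
have M0 := kb_ge0 H.
have [[_ [_ [cp1 _]]] _] := kp_k1 P; have [[_ [_ [cp2 _]]] _] := kp_k2 P.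
move=> c Ic; have [c0 c1] := andP (iffLR (I01P _) Ic).
pose b t := if t <= c then pd1 k1 c t (x t) else pd1 k2 c t (x t).
have bb t : I01 t -> `|b t| <= M.
  move=> It; rewrite /b; case: ifP => _.
    by apply: (c2b_bnd1 (kb_k1 H)); apply: box_of => //; exact: bx.
  by apply: (c2b_bnd1 (kb_k2 H)); apply: box_of => //; exact: bx.
have Xb : Xsp b.
  split; last by exists M.
  by apply: measurable_if_cont3 => //; case: hx.
exists (int01 b) => s Is; have [s0 s1] := andP (iffLR (I01P _) Is).
have Xs := kernel_Xsp Is hx bx; have Xc := kernel_Xsp Ic hx bx.
have -> : Kop k x s - Kop k x c - int01 b * (s - c) =
    int01 (fun t => k s t (x t) - k c t (x t) - (s - c) * b t).
  rewrite int01B; [|exact: Xsp_sub|exact: Xsp_scale].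
  by rewrite int01B// int01Z// [int01 b * _]mulrC.
have Xr : Xsp (fun t => k s t (x t) - k c t (x t) - (s - c) * b t).
  by apply: Xsp_sub; [exact: Xsp_sub|exact: Xsp_scale].
pose lo := Num.min s c; pose hi := Num.max s c.
have hlo : 0 <= lo by rewrite le_min s0 c0.
have hhi : hi <= 1 by rewrite ge_max s1 c1.
have lohi : lo <= hi by rewrite ge_min le_max lexx.
have dlh : hi - lo = `|s - c|.
  rewrite /hi /lo; case: (leP s c) => h.
    by rewrite ler0_norm ?subr_le0// opprB.
  by rewrite ger0_norm ?subr_ge0// ltW.
pose ind : R -> R := \1_(`[lo, hi]%classic).
have Xi : Xsp ind := @Xsp_indic R lo hi.
have -> : 3 * M * `|s - c| ^+ 2 =
    int01 (fun t => M * `|s - c| ^+ 2 + (2 * M * `|s - c|) * ind t).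
  rewrite int01D; [|exact: Xsp_cst|exact: Xsp_scale].
  rewrite int01_cst int01Z// (int01_indic hlo lohi hhi) dlh; ring.
apply: (le_trans (int01_norm Xr)); apply: int01_le.
- exact: Xsp_norm.
- by apply: Xsp_add; [exact: Xsp_cst|exact: Xsp_scale].
move=> t It; have [t0 t1] := andP (iffLR (I01P _) It).
have bxs : box B s t (x t) by apply: box_of => //; exact: bx.
have bxc : box B c t (x t) by apply: box_of => //; exact: bx.
have sc0 : 0 <= `|s - c| by [].
rewrite /ind indicE; case: (boolP (t \in _)) => /= [_|].
  rewrite mulr1; apply: (le_trans (ler_normB _ _)); rewrite normrM.
  have := kb_lip1 H bxs bxc; have := bb t It; have := exprn_ge0 2 sc0.
  by move=> h1 h2 h3; nra.
rewrite mulr0 addr0 notin_setE /= in_itv/= => nt.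
have [e1 e2] := kb_k H.
have [tc|ct] := leP t c.
  have ts : t <= s.
    rewrite leNgt; apply/negP => st; apply: nt.
    by rewrite ge_min le_max tc (ltW st) orbT.
  rewrite /b tc e1// e1// [(s - c) * _]mulrC.
  exact: (C2_box_taylor1 (kb_k1 H)).
have st : s <= t.
  rewrite leNgt; apply/negP => ts; apply: nt.
  by rewrite ge_min le_max (ltW ct) (ltW ts) orbT.
have tcF : (t <= c) = false by apply/negbTE; rewrite -ltNge.
rewrite /b tcF e2// e2// ?(ltW ct)// [(s - c) * _]mulrC.
exact: (C2_box_taylor1 (kb_k2 H)).
Qed.

Lemma nys_second_order phi L T : 0 <= L -> 0 <= T ->
  Xsp phi -> bddI B phi -> regular L T phi ->
  exists2 C, 0 <= C & forall n p s, (0 < n)%N -> (0 < p)%N -> I01 s ->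
    `|nys n p (fun t => k s t (phi t)) - Kop k phi s| <=
      C * (1 / (n * p)%:R) ^+ 2.
Proof.
move=> L0 T0 hphi bphi [lphi rphi]; have M0 := kb_ge0 H.
pose C1 := M * ((1 + L) ^+ 2 + T); pose C2 := M * (1 + L).
have C10 : 0 <= C1 by rewrite mulr_ge0// addr_ge0// exprn_ge0// addr_ge0.
have C20 : 0 <= C2 by rewrite mulr_ge0// addr_ge0.
exists (2 * (C1 + C2)); first by rewrite mulr_ge0// addr_ge0.
move=> n p s n0 p0 Is; rewrite distrC.
have m0 : (0 < n * p)%N by rewrite muln_gt0 n0.
set m := (n * p)%N in m0 *.
have mp : 0 < m%:R :> R by rewrite ltr0n.
(* The second summand is one order worse but occurs for at most one [i]; after summation with weight
   [2 / m] both are of order two. *)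
pose rho i : R := C1 * (1 / m%:R) ^+ 2 +
  C2 * (1 / m%:R) * (if (i.-1)%:R / m%:R < s <= i%:R / m%:R then 1 else 0).
apply: (le_trans (@nys_quadrature R n p (fun t => k s t (phi t)) rho n0 p0
  (kernel_Xsp Is hphi bphi) _)); last first.
  have e : \sum_(1 <= i < m.+1) (C1 * (1 / m%:R) ^+ 2) = C1 * (1 / m%:R) ^+ 2 * m%:R.
    by rewrite sumr_const_nat subn1 mulr_natr.
  rewrite -/m /rho big_split/= e -mulr_sumr.
  have hS := @sum_cell_indicator R m s; set S := \sum_(1 <= i < m.+1) _ in hS *.
  have -> : 2 * (C1 + C2) * (1 / m%:R) ^+ 2 = 2 / m%:R *
      (C1 * (1 / m%:R) ^+ 2 * m%:R + C2 * (1 / m%:R) * 1) :> R.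
    by field; rewrite gt_eqF.
  rewrite ler_wpM2l ?divr_ge0// lerD2l ler_wpM2l//.
  by rewrite mulr_ge0// divr_ge0.
rewrite -/m => i /andP[i0 im] a b.
have eb : b = a + 1 / m%:R by rewrite /b -(prednK i0) -natr1 mulrDl.
have a0 : 0 <= a by rewrite divr_ge0.
have b1 : b <= 1 by rewrite ler_pdivrMr// mul1r ler_nat.
have mi0 : 0 < 1 / m%:R :> R by rewrite divr_gt0.
pose c := (a + b) / 2.
have hc : a <= c <= b by rewrite /c; lra.
have Ic : I01 c by apply/I01P; lra.
have It t : a <= t <= b -> I01 t by move=> ht; apply/I01P; lra.
have dt t : a <= t <= b -> `|t - c| <= 1 / m%:R.
  by move=> ht; rewrite ler_norml; lra.
have [be hbe] := rphi c Ic.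
(* The slope in [t] follows the chain rule, with [be] in the role of the derivative of [phi] at the
   midpoint. *)
have smooth g : C2_box B M g -> (forall t u, a <= t <= b -> k s t u = g s t u) ->
  exists A be, forall t, a <= t <= b ->
    `|k s t (phi t) - A - be * (t - c)| <= C1 * (1 / m%:R) ^+ 2.
  move=> Hg eg; exists (g s c (phi c)).
  exists (pd2 g s c (phi c) + pd3 g s c (phi c) * be) => t ht.
  have bt := box_of Is (It t ht) (bphi _ (It t ht)).
  have bc := box_of Is Ic (bphi _ Ic).
  rewrite eg//.
  have -> : g s t (phi t) - g s c (phi c) -
     (pd2 g s c (phi c) + pd3 g s c (phi c) * be) * (t - c) =
     (g s t (phi t) - g s c (phi c) - (pd2 g s c (phi c) * (t - c) +
       pd3 g s c (phi c) * (phi t - phi c))) +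
     pd3 g s c (phi c) * (phi t - phi c - be * (t - c)) by ring.
  apply: (le_trans (ler_normD _ _)).
  have h1 := C2_box_taylor23 Hg bt bc.
  have h2 : `|pd3 g s c (phi c) * (phi t - phi c - be * (t - c))| <=
      M * (T * `|t - c| ^+ 2).
    by rewrite normrM ler_pM//; [exact: (c2b_bnd3 Hg)|exact: hbe (It t ht)].
  have h3 : (`|t - c| + `|phi t - phi c|) ^+ 2 <= ((1 + L) * `|t - c|) ^+ 2.
    rewrite lerXn2r ?nnegrE ?addr_ge0 ?mulr_ge0 ?addr_ge0//.
    by rewrite mulrDl mul1r lerD2l; exact: lphi (It t ht) Ic.
  have h4 : `|t - c| ^+ 2 <= (1 / m%:R) ^+ 2.
    by apply: lerXn2r; rewrite ?nnegrE ?(ltW mi0)//; exact: dt.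
  apply: (@le_trans _ _ (C1 * `|t - c| ^+ 2)); last by rewrite ler_wpM2l.
  have -> : C1 * `|t - c| ^+ 2 =
    M * ((1 + L) * `|t - c|) ^+ 2 + M * (T * `|t - c| ^+ 2) by rewrite /C1; ring.
  by apply: lerD => //; apply: (le_trans h1); rewrite ler_wpM2l.
have [e1 e2] := kb_k H; have /I01P/andP[s0 s1] := Is.
rewrite /rho -/a -/b; case: ifPn => [_|].
  exists (k s c (phi c)), 0 => t ht; rewrite mul0r subr0 mulr1.
  have bt := box_of Is (It t ht) (bphi _ (It t ht)).
  have bc := box_of Is Ic (bphi _ Ic).
  apply: (le_trans (kb_lip H bt bc)); rewrite subrr normr0 add0r.
  apply: (@le_trans _ _ (C2 * (1 / m%:R))); last by rewrite lerDr mulr_ge0// exprn_ge0// ltW.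
  rewrite /C2 -mulrA ler_wpM2l//.
  apply: (@le_trans _ _ ((1 + L) * `|t - c|)).
    by rewrite mulrDl mul1r lerD2l; exact: lphi (It t ht) Ic.
  by rewrite ler_wpM2l ?addr_ge0//; exact: dt.
rewrite mulr0 addr0 negb_and -leNgt -ltNge => /orP[sa|bs].
  apply: (smooth k2 (kb_k2 H)) => t u /andP[ht ht']; apply: e2 => //.
    exact: le_trans ht.
  exact: le_trans b1.
apply: (smooth k1 (kb_k1 H)) => t u /andP[ht ht']; apply: e1 => //.
  exact: le_trans ht.
by apply: (le_trans ht'); exact: ltW.
Qed.

End Regularity.

(** * The projection error and the Frechet derivative *)

Section Projection.
Variable R : realType.
Implicit Types (s t u : R) (x phi v : R -> R).
Variables (k k1 k2 l1 l2 : R -> R -> R -> R) (B M : R).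
Hypothesis P : kernel_pieces k k1 k2 l1 l2.
Hypothesis H : kernel_bound k k1 k2 l1 l2 B M.

Lemma bddI_norm phi t : bddI B phi -> I01 t -> `|phi t| <= B.
Proof. by move=> b It; rewrite ler_norml; exact: b. Qed.

Lemma qavg_bddI phi n p j : (0 < p)%N -> (1 <= j <= n)%N -> bddI B phi ->
  - B <= qavg n p j phi <= B.
Proof.
move=> p0 hj b; rewrite -ler_norml; apply: qavg_bound => // t /cell_I01 It.
exact: bddI_norm.
Qed.

Lemma sum_one_index n j0 (a b : R) : (1 <= j0 <= n)%N ->
  \sum_(1 <= j < n.+1) ((if j == j0 then a else 0) + b) = a + b * n%:R.
Proof.
move=> hj; rewrite big_split/= -big_mkcond/= big_nat1_eq ltnS hj.
by rewrite sumr_const_nat subn1 mulr_natr.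
Qed.

(* Off the cell of s the mean of phi - Q phi over each cell vanishes, which
   gains one order; the one remaining cell has length 1/n. *)
Lemma projection_third_order phi xq g L n p j0 s : 0 <= L -> (0 < n)%N -> (0 < p)%N ->
  lipI L phi -> bddI B phi -> cell n j0 s ->
  (forall j t, cell n j t -> xq t = qavg n p j phi) ->
  (forall s, g s =
    nys n p (fun t => k s t (phi t)) - nys n p (fun t => k s t (xq t))) ->
  `|g s - qavg n p j0 g| <= M * L * (2 + L) * (1 / n%:R) ^+ 3.
Proof.
move=> L0 n0 p0 lphi bphi cs hxq gE; have M0 := kb_ge0 H.
have np : 0 < n%:R :> R by rewrite ltr0n.
have hj0 : (1 <= j0 <= n)%N by case: cs.
(* Comparing the value at [s] with that at every [s'] of its cell turns the projection error into an
   increment in the first kernel variable. *)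
rewrite distrC; apply: qavg_dist => // s' cs'; rewrite distrC.
set h : R := 1 / n%:R; have h0 : 0 < h by rewrite divr_gt0.
have ss : `|s - s'| <= h := cell_diam cs cs'.
have [/I01P Is /I01P Is'] := (cell_I01 cs, cell_I01 cs').
have dphi j t : cell n j t -> `|phi t - qavg n p j phi| <= L * h.
  move=> ct; rewrite distrC; apply: qavg_dist => //; first by case: ct.
  move=> t' ct'; apply: (le_trans (lphi _ _ (cell_I01 ct') (cell_I01 ct))).
  by rewrite ler_wpM2l//; exact: cell_diam ct' ct.
pose D t := k s t (phi t) - k s' t (phi t) - (k s t (xq t) - k s' t (xq t)).
have -> : g s - g s' = nys n p D.
  by rewrite !gE /D !nysB; ring.
pose c j : R := (if j == j0 then M * L * h ^+ 2 else 0) + M * L * (1 + L) * h ^+ 3.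
apply: (@le_trans _ _ (1 / n%:R * \sum_(1 <= j < n.+1) c j)); last first.
  rewrite sum_one_index// -/h.
  have -> : n%:R = h^-1 by rewrite /h div1r invrK.
  have -> : h * (M * L * h ^+ 2 + M * L * (1 + L) * h ^+ 3 * h^-1) =
    M * L * (2 + L) * h ^+ 3; last exact: lexx.
  by field; rewrite gt_eqF.
apply: nys_cells => // j hj.
have bq := qavg_bddI p0 hj bphi.
set q := qavg n p j phi in bq.
have DE t : cell n j t ->
    D t = k s t (phi t) - k s' t (phi t) - (k s t q - k s' t q).
  by move=> ct; rewrite /D (hxq _ _ ct).
have b0 : 0 <= M * L * (1 + L) * h ^+ 3.
  by rewrite !mulr_ge0 ?addr_ge0// exprn_ge0// ltW.
rewrite /c; have [jj|jj] := eqVneq j j0.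
  rewrite ler_wpDr//; apply: qavg_bound => // t ct; rewrite DE//.
  have /I01P It := cell_I01 ct.
  apply: (le_trans (kb_mixed H Is Is' It (bphi _ (cell_I01 ct)) bq)).
  have -> : M * L * h ^+ 2 = M * h * (L * h) by ring.
  by rewrite ler_pM ?mulr_ge0// ?ler_wpM2l//; exact: dphi.
rewrite add0r.
(* [pd3 k] is frozen at the right end of the cell, which belongs to it: the factor must be constant
   in [t] for the zero mean of [phi - q] to remove it. *)
pose t0 : R := j%:R / n%:R.
have ct0 : cell n j t0.
  have [j1 jn] := andP hj; split => //; split => //; left.
  by rewrite ltr_pM2r ?invr_gt0// ltr_nat prednK.
have /I01P It0 := cell_I01 ct0.
(* [s] and [s'] share the cell [j0], so any other cell lies on one side of both and the diagonal is
   not crossed. *)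
have side : (forall t, cell n j t -> t <= s /\ t <= s') \/
            (forall t, cell n j t -> s <= t /\ s' <= t).
  have /andP[a1 a2] := cell_bounds cs; have /andP[a3 a4] := cell_bounds cs'.
  have [j1 jn] := andP hj; have [j01 j0n] := andP hj0.
  have [jlt|jgt|/eqP] := ltngtP j j0; last by rewrite (negbTE jj).
    left=> t /cell_bounds/andP[_ b2].
    have e : j%:R / n%:R <= (j0.-1)%:R / n%:R :> R.
      by rewrite ler_pM2r ?invr_gt0// ler_nat -ltnS prednK.
    by split; apply: (le_trans b2); apply: (le_trans e).
  right=> t /cell_bounds/andP[b1 _].
  have e : j0%:R / n%:R <= (j.-1)%:R / n%:R :> R.
    by rewrite ler_pM2r ?invr_gt0// ler_nat -ltnS prednK.
  by split; apply: le_trans b1; apply: le_trans e.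
pose d := pd3 k s t0 q - pd3 k s' t0 q.
have -> : qavg n p j D = qavg n p j (fun t => D t - d * (phi t - q)).
  rewrite qavgB qavgZ qavgB qavg_cst// -/q subrr mulr0 subr0 //.
apply: qavg_bound => // t ct; rewrite DE// /d.
have /I01P It := cell_I01 ct.
apply: (le_trans (kb_mixed_taylor H _ Is Is' It It0 (bphi _ (cell_I01 ct)) bq)).
  by case: side => hs; [left|right]; split; exact: hs.
have e1 := dphi _ _ ct; rewrite -/q in e1; have e2 := cell_diam ct ct0; rewrite -/h in e2.
have -> : M * L * (1 + L) * h ^+ 3 = M * h * (h + L * h) * (L * h) by ring.
have hh : `|t - t0| + `|phi t - q| <= h + L * h by exact: lerD.
by rewrite ler_pM ?mulr_ge0 ?addr_ge0// ler_pM ?mulr_ge0 ?addr_ge0// ler_wpM2l.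
Qed.

(** The integral form of K'(phi) v; [Kop_fderiv] justifies the identification. *)
Definition Lop phi v : R -> R := fun s => int01 (fun t => pd3 k s t (phi t) * v t).

Lemma Xsp_mul x v : Xsp x -> Xsp v -> Xsp (fun t => x t * v t).
Proof.
move=> [mx [a ha]] [mv [b hb]]; split; first exact: measurable_funM.
by exists (a * b) => t It; rewrite normrM ler_pM//; [exact: ha|exact: hb].
Qed.

Lemma Lop_lip phi v c : Xsp phi -> bddI B phi -> Xsp v ->
  (forall t, I01 t -> `|v t| <= c) -> lipI (M * c) (Lop phi v).
Proof.
move=> hphi bphi hv hc s t Is It; have M0 := kb_ge0 H.
have X r : I01 r -> Xsp (fun t => pd3 k r t (phi t) * v t).
  by move=> Ir; apply: Xsp_mul => //; exact: (dkernel_Xsp P H).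
rewrite /Lop -int01B; [|exact: X..].
apply: int01_bound; first by apply: Xsp_sub; exact: X.
move=> r Ir; rewrite -mulrBl normrM mulrAC ler_pM//; last exact: hc.
by apply: (lb_lip1 H); apply: box_of => //; exact: bphi.
Qed.

Lemma Lop_bound phi v c : Xsp phi -> bddI B phi -> Xsp v ->
  (forall t, I01 t -> `|v t| <= c) -> forall s, I01 s -> `|Lop phi v s| <= M * c.
Proof.
move=> hphi bphi hv hc s Is; have M0 := kb_ge0 H.
apply: int01_bound.
  by apply: Xsp_mul => //; exact: (dkernel_Xsp P H).
move=> t It; rewrite normrM ler_pM//; last exact: hc.
by apply: (lb_bnd H); apply: box_of => //; exact: bphi.
Qed.

Lemma Lop_bounded_linear phi : Xsp phi -> bddI B phi -> bounded_linear (Lop phi).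
Proof.
move=> hphi bphi; split; [|split].
- move=> a x y hx hy s Is.
  have Xl := dkernel_Xsp P H Is hphi bphi.
  rewrite /Lop /fadd /fscale -int01Z; last exact: Xsp_mul.
  rewrite -int01D; [|exact/Xsp_scale/Xsp_mul|exact: Xsp_mul].
  by congr int01; apply/funext => t; ring.
- move=> v hv; apply: (@lipI_Xsp _ (M * supn v)).
  by apply: Lop_lip => // t; exact: supn_ge.
- exists M => x hx; apply: supn_le; apply: Lop_bound => // t; exact: supn_ge.
Qed.

End Projection.

(** Links the eigenvalue hypothesis, which speaks of Frechet derivatives, to the explicit [Lop]. The
    extra 1 in the box keeps [phi + v] inside, as the radius [d] is at most 1. *)
Lemma Kop_fderiv (R : realType) (k k1 k2 l1 l2 : R -> R -> R -> R)
    (phi : R -> R) B M :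
  kernel_pieces k k1 k2 l1 l2 -> kernel_bound k k1 k2 l1 l2 (B + 1) M ->
  Xsp phi -> bddI B phi -> is_fderiv (Kop k) phi (Lop k phi).
Proof.
move=> P H hphi bphi; have M0 := kb_ge0 H.
have bphi1 : bddI (B + 1) phi by move=> t It; have := bphi t It; lra.
split; first exact: (Lop_bounded_linear P H).
move=> e e0; pose d := Num.min 1 (e / (M + 1)).
have M1 : 0 < M + 1 by lra.
have d0 : 0 < d by rewrite lt_min ltr01 divr_gt0.
exists d; split => // v hv vd.
have vb t : I01 t -> `|v t| <= supn v by exact: supn_ge.
have v0 := supn_ge0 hv.
have [v1 v2] : supn v < 1 /\ supn v < e / (M + 1).
  by move: vd; rewrite lt_min => /andP[].
have bv : bddI (B + 1) (fadd phi v).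
  move=> t It; have := vb t It; rewrite ler_norml /fadd => h.
  by have := bphi t It; lra.
apply: (@le_trans _ _ (M * supn v ^+ 2)); last first.
  rewrite expr2 mulrA ler_wpM2r//.
  move: v2; rewrite ltr_pdivlMr// => v2; nra.
apply: supn_le => s Is; rewrite /fsub /Kop -!/(int01 _) /Lop.
have X1 := kernel_Xsp P H Is (Xsp_add hphi hv) bv.
have X2 := kernel_Xsp P H Is hphi bphi1.
have X3 := Xsp_mul (dkernel_Xsp P H Is hphi bphi1) hv.
rewrite -int01B// -int01B//; last exact: Xsp_sub.
apply: int01_bound; first by apply: Xsp_sub => //; exact: Xsp_sub.
move=> t It.
have b1 := box_of Is It (bv _ It); have b2 := box_of Is It (bphi1 _ It).
have ev : phi t + v t - phi t = v t by ring.
have := kb_taylor3 H b1 b2; rewrite /fadd ev => h.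
by apply: (le_trans h); rewrite ler_wpM2l// lerXn2r ?nnegrE//; exact: vb.
Qed.

(** * Archimedean bounds *)

Section Asymptotics.
Variable R : realType.

Lemma inv_small (e : R) : 0 < e -> exists2 N, (0 < N)%N &
  forall n, (N <= n)%N -> 1 / n%:R <= e.
Proof.
move=> e0; exists (Num.bound e^-1).+1 => // n hn.
have np : 0 < n%:R :> R by rewrite ltr0n (leq_trans _ hn).
rewrite ler_pdivrMr// mulrC -ler_pdivrMr// div1r.
have h : e^-1 < (Num.bound e^-1)%:R by apply: archi_boundP; rewrite invr_ge0 ltW.
by apply: (le_trans (ltW h)); rewrite ler_nat (leq_trans _ hn).
Qed.

Lemma norm_small_eq0 (x K : R) : 0 <= K ->
  (forall e, 0 < e -> `|x| <= K * e) -> x = 0.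
Proof.
move=> K0 h; apply/normr0_eq0/eqP; rewrite eq_le normr_ge0 andbT.
apply/ler_addgt0Pr => e e0; rewrite add0r.
have K1 : 0 < K + 1 by lra.
have e1 : 0 < e / (K + 1) by rewrite divr_gt0.
apply: (le_trans (h _ e1)).
by rewrite mulrA ler_pdivrMr// mulrC ler_wpM2l ?ltW//; lra.
Qed.

End Asymptotics.

(** * The projection and the discrete equation *)

Section DiscreteEquation.
Variable R : realType.
Variables (n p : nat) (Q : (R -> R) -> (R -> R)).
Hypotheses (n0 : (0 < n)%N) (p0 : (0 < p)%N) (HQ : is_Qn n p Q).

Lemma Q_add x y : Xsp x -> Xsp y -> eqI (Q (fadd x y)) (fadd (Q x) (Q y)).
Proof.
move=> hx hy t It; have := HQ.1 1 x y hx hy t It.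
have -> : fadd (fscale 1 x) y = fadd x y.
  by apply/funext => s; rewrite /fadd /fscale mul1r.
by rewrite /fadd /fscale mul1r.
Qed.

Lemma Q_sub x y : Xsp x -> Xsp y -> eqI (Q (fsub x y)) (fsub (Q x) (Q y)).
Proof.
move=> hx hy t It; rewrite !fsubE; exact: HQ.1.
Qed.

(** Elements of the space are compared on [0,1] only, whereas [Q] acts on functions on the line and
    could look outside. Linearity and boundedness exclude this: a difference of norm zero has an
    image of norm zero. *)
Lemma Q_eqI x y : Xsp x -> Xsp y -> eqI x y -> eqI (Q x) (Q y).
Proof.
move=> hx hy e t It; apply/eqP; rewrite -subr_eq0 -normr_le0.
have [_ [XQ [_ [[c hc] _]]]] := HQ.
have Xd := Xsp_sub hx hy.
have s0 : supn (fsub x y) = 0.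
  apply/le_anti; rewrite supn_ge0// andbT; apply: supn_le => s Is.
  by rewrite /fsub e// subrr normr0.
have := Q_sub hx hy It; rewrite {2}/fsub => <-.
apply: (le_trans (supn_ge (XQ _ Xd).1 It)).
by apply: (le_trans (hc _ Xd)); rewrite s0 mulr0.
Qed.

Lemma Kmop_nys (k : R -> R -> R -> R) x s :
  Kmop k n p x s = nys n p (fun t => k s t (x t)).
Proof. by []. Qed.

Lemma nys_lip (k k1 k2 l1 l2 : R -> R -> R -> R) B M x :
  kernel_bound k k1 k2 l1 l2 B M -> bddI B x -> lipI M (Kmop k n p x).
Proof.
move=> H bx s s' Is Is'; rewrite !Kmop_nys -nysB; apply: nys_bound => // t It.
by apply: (kb_lip1 H); apply: box_of => //; exact: bx.
Qed.

Lemma Kmop_continuous (k k1 k2 l1 l2 : R -> R -> R -> R) x :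
  kernel_pieces k k1 k2 l1 l2 -> Xsp x -> {within @I01 R, continuous (Kmop k n p x)}.
Proof.
move=> P [_ [B hB]]; have [M H] := kernel_boundP B P.
apply: lipI_continuous (nys_lip H _) => t It.
by rewrite -ler_norml; exact: hB.
Qed.

(* Q z is determined by values of Q on continuous functions only, although z
   itself is discontinuous and the norm of the extension Q is not controlled
   uniformly in n and p. *)
Lemma discrete_equation (k k1 k2 l1 l2 : R -> R -> R -> R) f z :
  kernel_pieces k k1 k2 l1 l2 -> {within @I01 R, continuous f} -> Xsp z ->
  eqI (fsub z (KtM k n p Q z)) f ->
  forall j t, cell n j t ->
    Q z t = qavg n p j (fun s => f s + Kmop k n p z s) /\
    z t = f t + qavg n p j (Kmop k n p z) + Kmop k n p (Q z) t
      - qavg n p j (Kmop k n p (Q z)).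
Proof.
move=> P cf hz ez j t ct; have It := cell_I01 ct.
have [_ [XQ [Qid [_ Qcont]]]] := HQ.
have ca := Kmop_continuous P hz; have cb := Kmop_continuous P (XQ _ hz).1.
set a := Kmop k n p z in ca *; set b := Kmop k n p (Q z) in cb *.
have [Xf [Xa Xb]] : Xsp f /\ Xsp a /\ Xsp b by split; [|split]; exact: continuous_Xsp.
have [XQa XnQa] := XQ _ Xa; have [XQb XnQb] := XQ _ Xb.
have zE : eqI z (fadd (fadd f (Q a)) (fsub b (Q b))).
  move=> s Is; have := ez s Is; rewrite /fsub /KtM /fsub /fadd -/a -/b => <-.
  by ring.
split; last first.
  by rewrite zE// /fadd /fsub -(Qcont _ ca _ _ ct) -(Qcont _ cb _ _ ct); ring.
have Xs : Xsp (fadd (fadd f (Q a)) (fsub b (Q b))).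
  by apply: Xsp_add; [exact: Xsp_add|exact: Xsp_sub].
(* [Q] fixes [Q a] and annihilates [b - Q b], leaving [Q f + Q a], two values on continuous
   functions. *)
rewrite (Q_eqI hz Xs zE It) Q_add//; [|exact: Xsp_add|exact: Xsp_sub].
rewrite {1}/fadd Q_add// Q_sub// /fadd /fsub (Qid _ XQa XnQa _ It) (Qid _ XQb XnQb _ It).
by rewrite qavgD -(Qcont _ ca _ _ ct) -(Qcont _ cf _ _ ct); ring.
Qed.

End DiscreteEquation.

(** * Convergence and error estimate *)

Section Convergence.
Variable R : realType.
Variables (k k1 k2 l1 l2 : R -> R -> R -> R) (B M : R).
Hypothesis P : kernel_pieces k k1 k2 l1 l2.
Hypothesis H : kernel_bound k k1 k2 l1 l2 B M.
Variables (f phi : R -> R) (F L T : R).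
Hypotheses (F0 : 0 <= F) (lf : lipI F f).
Hypotheses (Xphi : Xsp phi) (bphi : bddI B phi).
Hypothesis phi_eq : forall s, I01 s -> phi s = f s + Kop k phi s.
Hypothesis phi_uniq :
  forall y, Xsp y -> eqI (fsub y (Kop k y)) f -> eqI y phi.
Hypotheses (L0 : 0 <= L) (T0 : 0 <= T) (rphi : regular L T phi).

(** Here [Q] disappears: [u] and [w] stand for [Q z] and [Q phi] and enter only through cell
    averages. The bounds keep all kernel arguments in one box, the same for all [n] and [p]. *)
Record discrete_solution n p (z u w : R -> R) : Prop := {
  ds_n : (0 < n)%N ;
  ds_p : (0 < p)%N ;
  ds_Xz : Xsp z ;
  ds_bz : bddI B z ;
  ds_bu : bddI B u ;
  ds_bv : bddI B (fun s => f s + Kmop k n p z s) ;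
  ds_u : forall j t, cell n j t -> u t = qavg n p j (fun s => f s + Kmop k n p z s) ;
  ds_z : forall j t, cell n j t -> z t = f t + qavg n p j (Kmop k n p z) +
    Kmop k n p u t - qavg n p j (Kmop k n p u) ;
  ds_w : forall j t, cell n j t -> w t = qavg n p j phi }.

Lemma qavg_lip n p j (s : R) (g : R -> R) (c : R) :
  (0 < p)%N -> cell n j s -> 0 <= c -> lipI c g ->
  `|g s - qavg n p j g| <= c / n%:R.
Proof.
move=> p0 cs c0 lg; rewrite distrC; apply: qavg_dist => //; first by case: cs.
move=> t ct; apply: (le_trans (lg _ _ (cell_I01 ct) (cell_I01 cs))).
by rewrite ler_wpM2l// -div1r; exact: cell_diam ct cs.
Qed.

(** The discrepancy consists of the projection errors of the [M]-Lipschitz functions K_m z and K_m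
    u, each at most M/n. *)
Lemma solution_near_lip n p z u w s : discrete_solution n p z u w -> I01 s ->
  `|z s - (f s + Kmop k n p z s)| <= 2 * M / n%:R.
Proof.
move=> S Is; have M0 := kb_ge0 H.
have [j cj] := cell_exists (ds_n S) Is.
rewrite (ds_z S cj).
have h1 := qavg_lip (ds_p S) cj M0 (nys_lip (ds_n S) (ds_p S) H (ds_bz S)).
have h2 := qavg_lip (ds_p S) cj M0 (nys_lip (ds_n S) (ds_p S) H (ds_bu S)).
set a := Kmop k n p z in h1 *; set b := Kmop k n p u in h2 *.
have -> : f s + qavg n p j a + b s - qavg n p j b - (f s + a s) =
  (b s - qavg n p j b) - (a s - qavg n p j a) by ring.
by apply: (le_trans (ler_normB _ _)); lra.
Qed.

Lemma kernel_comp_lip s y Ly : 0 <= Ly -> I01 s -> bddI B y -> lipI Ly y ->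
  lipI (M * (1 + Ly)) (fun t => k s t (y t)).
Proof.
move=> Ly0 Is by_ ly t t' It It'; have M0 := kb_ge0 H.
apply: (le_trans (kb_lip H (box_of Is It (by_ _ It)) (box_of Is It' (by_ _ It')))).
rewrite subrr normr0 add0r -mulrA ler_wpM2l// mulrDl mul1r lerD2l; exact: ly.
Qed.

Lemma dkernel_comp_lip s y Ly : 0 <= Ly -> I01 s -> bddI B y -> lipI Ly y ->
  lipI (M * (1 + Ly)) (fun t => pd3 k s t (y t)).
Proof.
move=> Ly0 Is by_ ly t t' It It'; have M0 := kb_ge0 H.
apply: (le_trans (lb_lip H (box_of Is It (by_ _ It)) (box_of Is It' (by_ _ It')))).
rewrite subrr normr0 add0r -mulrA ler_wpM2l// mulrDl mul1r lerD2l; exact: ly.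
Qed.

Lemma solutions_converge eta : 0 < eta -> exists N, forall n p z u w,
  (N <= n)%N -> discrete_solution n p z u w ->
  forall t, I01 t -> `|z t - phi t| <= eta.
Proof.
move=> eta0; apply: contrapT => nex; have M0 := kb_ge0 H.
have /choice[q hq] : forall N : nat,
    exists q : nat * nat * (R -> R) * (R -> R) * (R -> R),
    [/\ (N <= q.1.1.1.1)%N,
      discrete_solution q.1.1.1.1 q.1.1.1.2 q.1.1.2 q.1.2 q.2 &
      exists t, I01 t /\ eta < `|q.1.1.2 t - phi t|].
  move=> N; apply: contrapT => hN; apply: nex; exists N => n p z u w Nn S t It.
  rewrite leNgt; apply/negP => lt; apply: hN.
  by exists (n, p, z, u, w); split => //; exists t.
pose n_ N := (q N).1.1.1.1; pose p_ N := (q N).1.1.1.2.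
pose z_ N := (q N).1.1.2.
pose v N s := f s + Kmop k (n_ N) (p_ N) (z_ N) s.
(* Compactness is applied to [v N], because [z_ N] may jump between cells. *)
have lv N : lipI (F + M) (v N).
  have [_ S _] := hq N => s t Is It.
  have -> : v N s - v N t = (f s - f t) + (Kmop k (n_ N) (p_ N) (z_ N) s -
    Kmop k (n_ N) (p_ N) (z_ N) t) by rewrite /v; ring.
  apply: (le_trans (ler_normD _ _)); rewrite mulrDl; apply: lerD; first exact: lf.
  exact: (nys_lip (ds_n S) (ds_p S) H (ds_bz S)).
have bv N t : I01 t -> `|v N t| <= B.
  by move=> It; have [_ S _] := hq N; exact: (bddI_norm (ds_bv S)).
have FM0 : 0 <= F + M by rewrite addr_ge0.
have [y [ly by_ cy]] := lipI_cluster FM0 lv bv.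
have by1 : bddI B y by move=> t It; rewrite -ler_norml; exact: by_.
have close e : 0 < e -> exists N,
    [/\ forall t, I01 t -> `|v N t - y t| <= e,
        forall t, I01 t -> `|z_ N t - y t| <= (1 + 2 * M) * e & 1 / (n_ N)%:R <= e].
  move=> e0; have [N0 _ hN0] := inv_small e0.
  have [N NN hN] := cy e e0 N0; exists N; have [Nn S _] := hq N.
  have n1 : 1 / (n_ N)%:R <= e by apply: hN0; exact: (leq_trans NN Nn).
  split => // t It.
  have h := solution_near_lip S It; have h' := hN t It.
  have -> : z_ N t - y t = (z_ N t - v N t) + (v N t - y t) by ring.
  apply: (le_trans (ler_normD _ _)); rewrite mulrDl mul1r addrC; apply: lerD => //.
  by apply: (le_trans h); rewrite ler_wpM2l ?mulr_ge0// -div1r.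
have Xy := lipI_Xsp ly.
have yphi : eqI y phi.
  apply: phi_uniq => // s Is; rewrite /fsub; apply/eqP; rewrite -subr_eq0; apply/eqP.
  (* The three terms account for the distance of [v N] to [y], that of [z_ N] to [y] inside the
     kernel, and the quadrature error. *)
  pose K := 1 + M * (1 + 2 * M) + 2 * (M * (1 + (F + M))).
  have K0 : 0 <= K by rewrite /K !addr_ge0// !mulr_ge0// !addr_ge0// mulr_ge0.
  apply: (@norm_small_eq0 _ _ K K0) => e e0.
  have [N [h1 h2 h3]] := close e e0; have [_ S _] := hq N.
  have lk := kernel_comp_lip FM0 Is by1 ly.
  have q1 := nys_cvg (ds_n S) (ds_p S) (mulr_ge0 M0 (addr_ge0 ler01 FM0)) lk.
  have q2 : `|nys (n_ N) (p_ N) (fun t => k s t (z_ N t)) -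
      nys (n_ N) (p_ N) (fun t => k s t (y t))| <= M * ((1 + 2 * M) * e).
    rewrite -nysB; apply: nys_bound; [exact: ds_n S|exact: ds_p S|] => t It.
    apply: (le_trans (kb_lip3 H (box_of Is It (ds_bz S It)) (box_of Is It (by1 _ It)))).
    by rewrite ler_wpM2l//; exact: h2.
  have q3 := h1 s Is.
  have -> : y s - Kop k y s - f s = - (v N s - y s) +
    ((nys (n_ N) (p_ N) (fun t => k s t (z_ N t)) -
      nys (n_ N) (p_ N) (fun t => k s t (y t))) -
     (int01 (fun t => k s t (y t)) - nys (n_ N) (p_ N) (fun t => k s t (y t)))).
    by rewrite /v Kmop_nys /Kop /int01; ring.
  apply: (le_trans (ler_normD _ _)); rewrite normrN.
  apply: (le_trans (lerD (lexx _) (ler_normB _ _))).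
  have q4 : 2 * (M * (1 + (F + M))) / (n_ N)%:R <= 2 * (M * (1 + (F + M))) * e.
    by apply: ler_wpM2l; [rewrite !mulr_ge0// addr_ge0|rewrite -div1r].
  have -> : K * e = e + (M * ((1 + 2 * M) * e) + 2 * (M * (1 + (F + M))) * e).
    by rewrite /K; ring.
  by apply: lerD => //; apply: lerD => //; exact: (le_trans q1).
have M1 : 0 < 1 + 2 * M by lra.
have e0 : 0 < eta / (1 + 2 * M) by rewrite divr_gt0.
have [N [_ h2 _]] := close _ e0; have [_ _ [t [It]]] := hq N.
rewrite ltNge => /negP; apply; rewrite -yphi//.
by apply: (le_trans (h2 t It)); rewrite mulrC divfK// gt_eqF.
Qed.

Let eps n p : R := Num.max ((1 / (n * p)%:R) ^+ 2) ((1 / n%:R) ^+ 3).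

Lemma linearized_error : exists2 C, 0 <= C & forall n p z u w r,
  discrete_solution n p z u w -> (forall t, I01 t -> `|z t - phi t| <= r) ->
  forall s, I01 s ->
    `|z s - phi s - nys n p (fun t => pd3 k s t (phi t) * (z t - phi t))| <=
      C * (eps n p + r / n%:R + r ^+ 2).
Proof.
have M0 := kb_ge0 H.
have [C1 C10 hC1] := nys_second_order P H L0 T0 Xphi bphi rphi.
pose C2 := M * L * (2 + L).
have C20 : 0 <= C2 by rewrite !mulr_ge0// addr_ge0.
exists (C1 + C2 + M + M * M + M * C1).
  by rewrite !addr_ge0// mulr_ge0.
move=> n p z u w r S hr s Is; have [n0 p0] := (ds_n S, ds_p S).
have [j cj] := cell_exists n0 Is.
have hj : (1 <= j <= n)%N by case: cj.
have r0 : 0 <= r by apply: le_trans (hr s Is).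
have np : 0 < n%:R :> R by rewrite ltr0n.
have h1 : 1 / n%:R <= 1 :> R by rewrite ler_pdivrMr// mul1r ler1n.
have h0 : 0 <= 1 / n%:R :> R by rewrite divr_ge0.
set h : R := 1 / n%:R in h1 h0.
have rhE : r / n%:R = h * r by rewrite /h div1r mulrC.
have e1 : (1 / (n * p)%:R) ^+ 2 <= eps n p by rewrite le_max lexx.
have e2 : h ^+ 3 <= eps n p by rewrite le_max lexx orbT.
set ep := eps n p in e1 e2 *.
have ep0 : 0 <= ep by apply: le_trans e2; rewrite exprn_ge0.
have bw : bddI B w.
  move=> t It; have [i ci] := cell_exists n0 It.
  by rewrite (ds_w S ci); apply: qavg_bddI => //; case: ci.
have K1 t : I01 t -> `|Kmop k n p phi t - Kop k phi t| <= C1 * ep.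
  by move=> It; apply: (le_trans (hC1 n p t n0 p0 It)); rewrite ler_wpM2l.
pose g t := Kmop k n p phi t - Kmop k n p w t.
have T2 : `|g s - qavg n p j g| <= C2 * ep.
  apply: (le_trans (projection_third_order H L0 n0 p0 rphi.1 bphi cj (ds_w S)
    (fun t => erefl (g t)))).
  by rewrite ler_wpM2l.
(* The Lipschitz constant carries the factor [d], so projecting a difference of size [d] costs only
   a multiple of [d / n]. *)
have diff_lip x y d : bddI B x -> bddI B y -> 0 <= d ->
    (forall t, I01 t -> `|x t - y t| <= d) ->
    lipI (M * d) (fun t => Kmop k n p x t - Kmop k n p y t).
  move=> bx by_ d0 hd t t' It It'.
  have -> : Kmop k n p x t - Kmop k n p y t - (Kmop k n p x t' - Kmop k n p y t') =
    nys n p (fun a => k t a (x a) - k t' a (x a) - (k t a (y a) - k t' a (y a))).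
    by rewrite !nysB !Kmop_nys; ring.
  apply: nys_bound => // a Ia.
  move/I01P: It => It; move/I01P: It' => It'; have /I01P Ia' := Ia.
  apply: (le_trans (kb_mixed H It It' Ia' (bx _ Ia) (by_ _ Ia))).
  by rewrite mulrAC ler_wpM2r// ler_wpM2l//; exact: hd.
pose G t := Kmop k n p z t - Kmop k n p phi t.
have T3 : `|G s - qavg n p j G| <= M * r * h.
  by rewrite /h div1r; apply: qavg_lip => //; [rewrite mulr_ge0|
    exact: diff_lip (ds_bz S) bphi r0 hr].
have KG t : I01 t -> `|G t| <= M * r.
  move=> It; rewrite /G !Kmop_nys -nysB; apply: nys_bound => // a Ia.
  apply: (le_trans (kb_lip3 H (box_of It Ia (ds_bz S Ia)) (box_of It Ia (bphi Ia)))).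
  by rewrite ler_wpM2l//; exact: hr.
(* Both functions are cell averages, so their difference averages f + K_m z - phi, which the
   equation for [phi] rewrites as [G] plus the quadrature error. *)
have du t : I01 t -> `|u t - w t| <= M * r + C1 * ep.
  move=> It; have [i ci] := cell_exists n0 It.
  rewrite (ds_u S ci) (ds_w S ci) -qavgB; apply: qavg_bound => //; first by case: ci.
  move=> a /cell_I01 Ia; rewrite phi_eq//.
  have -> : f a + Kmop k n p z a - (f a + Kop k phi a) =
    G a + (Kmop k n p phi a - Kop k phi a) by rewrite /G; ring.
  by apply: (le_trans (ler_normD _ _)); apply: lerD; [exact: KG|exact: K1].
have d0 : 0 <= M * r + C1 * ep by rewrite addr_ge0// mulr_ge0.
pose W t := Kmop k n p u t - Kmop k n p w t.
have T5 : `|W s - qavg n p j W| <= M * (M * r + C1 * ep) * h.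
  by rewrite /h div1r; apply: qavg_lip => //; [rewrite mulr_ge0|
    exact: diff_lip (ds_bu S) bw d0 du].
pose D := nys n p (fun t => pd3 k s t (phi t) * (z t - phi t)).
have T4 : `|G s - D| <= M * r ^+ 2.
  rewrite /G /D !Kmop_nys -!nysB; apply: nys_bound => // a Ia.
  apply: (le_trans (kb_taylor3 H (box_of Is Ia (ds_bz S Ia)) (box_of Is Ia (bphi Ia)))).
  by rewrite ler_wpM2l// lerXn2r ?nnegrE//; exact: hr.
have T1 := K1 s Is.
rewrite -/D (ds_z S cj) (phi_eq Is).
(* An exact identity: the terms with [w] cancel between [g] and [W], and [D] is the linear part of
   [G]. *)
have -> : f s + qavg n p j (Kmop k n p z) + Kmop k n p u s -
    qavg n p j (Kmop k n p u) - (f s + Kop k phi s) - D =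
    (Kmop k n p phi s - Kop k phi s) - (g s - qavg n p j g) -
    (G s - qavg n p j G) + (G s - D) + (W s - qavg n p j W).
  by rewrite /g /G /W !qavgB; ring.
apply: (le_trans (ler_normD _ _)).
apply: (@le_trans _ _ (C1 * ep + C2 * ep + M * r * h + M * r ^+ 2 +
  M * (M * r + C1 * ep) * h)).
  apply: lerD => //; apply: (le_trans (ler_normD _ _)); apply: lerD => //.
  apply: (le_trans (ler_normB _ _)); apply: lerD => //.
  by apply: (le_trans (ler_normB _ _)); apply: lerD.
rewrite rhE.
have MC : 0 <= M * C1 * ep by rewrite !mulr_ge0.
have MCh : M * C1 * ep * h <= M * C1 * ep by rewrite ler_piMr.
have q1 : 0 <= (C1 + C2 + M * C1) * (h * r + r ^+ 2).
  by rewrite mulr_ge0// !addr_ge0// ?mulr_ge0// exprn_ge0.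
have q2 : 0 <= (M + M * M) * ep by rewrite mulr_ge0// addr_ge0// mulr_ge0.
have q3 : 0 <= M * M * r ^+ 2 by rewrite !mulr_ge0// exprn_ge0.
have -> : (C1 + C2 + M + M * M + M * C1) * (ep + h * r + r ^+ 2) =
  C1 * ep + C2 * ep + M * r * h + M * r ^+ 2 + (M * M * r * h + M * C1 * ep) +
   ((C1 + C2 + M * C1) * (h * r + r ^+ 2) + (M + M * M) * ep + M * M * r ^+ 2) by ring.
have -> : M * (M * r + C1 * ep) * h = M * M * r * h + M * C1 * ep * h by ring.
by lra.
Qed.

Hypothesis phi_regular_value :
  forall v, Xsp v -> eqI (Lop k phi v) v -> eqI v (fun=> 0).

Lemma error_estimate : exists (C : R) (N : nat), forall n p z u w,
  (N <= n)%N -> discrete_solution n p z u w ->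
  supn (fsub z phi) <= C * eps n p.
Proof.
apply: contrapT => nex; have M0 := kb_ge0 H.
have /choice[q hq] : forall N : nat,
    exists q : nat * nat * (R -> R) * (R -> R) * (R -> R),
    [/\ (N <= q.1.1.1.1)%N,
      discrete_solution q.1.1.1.1 q.1.1.1.2 q.1.1.2 q.1.2 q.2 &
      N%:R * eps q.1.1.1.1 q.1.1.1.2 < supn (fsub q.1.1.2 phi)].
  move=> N; apply: contrapT => hN; apply: nex; exists N%:R, N => n p z u w Nn S.
  rewrite leNgt; apply/negP => lt; apply: hN.
  by exists (n, p, z, u, w).
pose n_ N := (q N).1.1.1.1; pose p_ N := (q N).1.1.1.2.
pose z_ N := (q N).1.1.2; pose r N := supn (fsub (z_ N) phi).
pose e N t := z_ N t - phi t.
have eps0 n p : 0 <= eps n p by rewrite le_max exprn_ge0 ?orbT// divr_ge0.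
have Xe N : Xsp (fsub (z_ N) phi) by have [_ S _] := hq N; exact: Xsp_sub (ds_Xz S) Xphi.
have er N t : I01 t -> `|e N t| <= r N by move=> It; exact: (supn_ge (Xe N) It).
have r0 N : 0 < r N.
  by have [_ _ h] := hq N; apply: le_lt_trans h; rewrite mulr_ge0.
have [C C0 hC] := linearized_error.
(* The linear part of the error, normalized by the error norm. Unlike the normalized error itself,
   these functions are equi-Lipschitz. *)
pose d N s := (r N)^-1 * nys (n_ N) (p_ N) (fun t => pd3 k s t (phi t) * e N t).
have dE N s : d N s = nys (n_ N) (p_ N) (fun t => pd3 k s t (phi t) * ((r N)^-1 * e N t)).
  rewrite /d -nysZ; congr nys; apply/funext => t; ring.
have er1 N t : I01 t -> `|(r N)^-1 * e N t| <= 1.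
  move=> It; rewrite normrM gtr0_norm ?invr_gt0// mulrC ler_pdivrMr// mul1r; exact: er.
have ld N : lipI M (d N).
  have [_ S _] := hq N => s t Is It; rewrite !dE -nysB.
  apply: nys_bound; [exact: ds_n S|exact: ds_p S|] => a Ia.
  rewrite -mulrBl normrM -[leRHS]mulr1 ler_pM//; last exact: er1.
  by apply: (lb_lip1 H); apply: box_of => //; exact: bphi.
have bd N t : I01 t -> `|d N t| <= M.
  have [_ S _] := hq N => It; rewrite dE.
  apply: nys_bound; [exact: ds_n S|exact: ds_p S|] => a Ia.
  rewrite normrM -[leRHS]mulr1 ler_pM//; last exact: er1.
  by apply: (lb_bnd H); apply: box_of => //; exact: bphi.
have [y [ly by_ cy]] := lipI_cluster M0 ld bd.
have Xy := lipI_Xsp ly.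
(* Large [N] makes [1 / n], [r N] and, through the negated estimate, [eps / r N] at most [a]. The
   remainders eps, r/n and r^2 are then each at most [a r], whence [3 C]; the summand 1 is the
   distance of [d N] to [y]. *)
have close a : 0 < a -> exists N,
    [/\ forall t, I01 t -> `|d N t - y t| <= a,
        forall t, I01 t -> `|(r N)^-1 * e N t - y t| <= (1 + 3 * C) * a
      & 1 / (n_ N)%:R <= a].
  move=> a0; have [N0 N00 hN0] := inv_small a0; have [N1 hN1] := solutions_converge a0.
  have [N NN hN] := cy a a0 (maxn N0 N1); exists N; have [Nn S hr] := hq N.
  have [NN0 NN1] : (N0 <= N)%N /\ (N1 <= N)%N.
    by split; apply: leq_trans NN; rewrite ?leq_maxl ?leq_maxr.
  have n1 : 1 / (n_ N)%:R <= a by apply: hN0; exact: (leq_trans NN0 Nn).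
  have ra : r N <= a.
    by apply: supn_le => t It; apply: (hN1 _ _ _ _ _ (leq_trans NN1 Nn) S).
  have Np : 0 < N%:R :> R by rewrite ltr0n (leq_trans N00).
  have epa : eps (n_ N) (p_ N) <= a * r N.
    apply: (@le_trans _ _ ((1 / N%:R) * r N)).
      by rewrite mulrC mulrA mulr1 ler_pdivlMr// mulrC; exact: ltW.
    by apply: ler_wpM2r; [exact: ltW|exact: hN0].
  split => // t It.
  have h := hC _ _ _ _ _ _ S (er N) t It; have h' := hN t It.
  have -> : (r N)^-1 * e N t - y t = (r N)^-1 *
    (e N t - nys (n_ N) (p_ N) (fun s => pd3 k t s (phi s) * e N s)) + (d N t - y t).
    by rewrite /d; ring.
  apply: (le_trans (ler_normD _ _)); rewrite mulrDl mul1r addrC; apply: lerD => //.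
  rewrite normrM gtr0_norm ?invr_gt0// mulrC ler_pdivrMr//.
  apply: (le_trans h).
  have -> : 3 * C * a * r N = C * (a * r N + a * r N + a * r N) by ring.
  rewrite ler_wpM2l//; apply: lerD; [apply: lerD => //|].
    by rewrite mulrC ler_wpM2r ?(ltW (r0 N))// -div1r.
  by rewrite expr2 ler_wpM2r// ltW.
have yL : eqI (Lop k phi y) y.
  move=> s Is; apply/eqP; rewrite -subr_eq0; apply/eqP.
  pose Cy := M * (1 + L) * M + M * M.
  have Cy0 : 0 <= Cy by rewrite addr_ge0// !mulr_ge0// addr_ge0.
  pose K := 2 * Cy + (M * (1 + 3 * C) + 1).
  have K0 : 0 <= K by rewrite /K !addr_ge0// mulr_ge0// addr_ge0// mulr_ge0.
  apply: (@norm_small_eq0 _ _ K K0) => a a0.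
  have [N [h1 h2 h3]] := close a a0; have [_ S _] := hq N.
  have lg : lipI Cy (fun t => pd3 k s t (phi t) * y t).
    move=> t t' It It'.
    have -> : pd3 k s t (phi t) * y t - pd3 k s t' (phi t') * y t' =
      (pd3 k s t (phi t) - pd3 k s t' (phi t')) * y t +
      pd3 k s t' (phi t') * (y t - y t') by ring.
    apply: (le_trans (ler_normD _ _)); rewrite /Cy [leRHS]mulrDl !normrM; apply: lerD.
      rewrite mulrAC ler_pM//; last exact: by_.
      exact: (dkernel_comp_lip L0 Is bphi rphi.1).
    rewrite -mulrA ler_pM//; last exact: ly.
    by apply: (lb_bnd H); apply: box_of => //; exact: bphi.
  have q1 := nys_cvg (ds_n S) (ds_p S) Cy0 lg.
  have q2 : `|nys (n_ N) (p_ N) (fun t => pd3 k s t (phi t) * ((r N)^-1 * e N t)) -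
      nys (n_ N) (p_ N) (fun t => pd3 k s t (phi t) * y t)| <= M * ((1 + 3 * C) * a).
    rewrite -nysB; apply: nys_bound; [exact: ds_n S|exact: ds_p S|] => t It.
    rewrite -mulrBr normrM ler_pM//; last exact: h2.
    by apply: (lb_bnd H); apply: box_of => //; exact: bphi.
  have q3 := h1 s Is.
  have -> : Lop k phi y s - y s =
    (int01 (fun t => pd3 k s t (phi t) * y t) -
      nys (n_ N) (p_ N) (fun t => pd3 k s t (phi t) * y t)) +
    (- (nys (n_ N) (p_ N) (fun t => pd3 k s t (phi t) * ((r N)^-1 * e N t)) -
      nys (n_ N) (p_ N) (fun t => pd3 k s t (phi t) * y t)) + (d N s - y s)).
    by rewrite dE /Lop; ring.
  apply: (le_trans (ler_normD _ _)).
  apply: (le_trans (lerD (lexx _) (ler_normD _ _))); rewrite normrN.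
  have -> : K * a = 2 * Cy * a + (M * ((1 + 3 * C) * a) + a) by rewrite /K; ring.
  apply: lerD; last exact: lerD.
  apply: (le_trans q1); apply: ler_wpM2l; first by rewrite mulr_ge0.
  by rewrite -div1r.
have y0 := phi_regular_value Xy yL.
have C1 : 0 < 2 * (1 + 3 * C) by lra.
(* With [y = 0] this choice bounds the normalized error by 1/2 on [0,1], although its sup norm is
   1. *)
have a0 : 0 < 1 / (2 * (1 + 3 * C)) by rewrite divr_gt0.
have [N [_ h2 _]] := close _ a0.
suff : r N <= r N / 2 by have := r0 N; lra.
apply: supn_le => t It; have := h2 t It; rewrite y0// subr0 normrM.
rewrite gtr0_norm ?invr_gt0// mulrC ler_pdivrMr// => h; apply: (le_trans h).
have -> : (1 + 3 * C) * (1 / (2 * (1 + 3 * C))) * r N = r N / 2; last exact: lexx.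
by field; rewrite gt_eqF//; lra.
Qed.

End Convergence.

(** * The convergence rate of the discrete modified projection solution *)

Theorem theorem4p2 (R : realType) (kappa : R -> R -> R -> R) (f phi : R -> R)
  (Q : nat -> nat -> (R -> R) -> (R -> R)) (delta0 : R) :
  class_G2_2_0 kappa ->
  C2_01 f ->
  (* K is twice Frechet differentiable *)
  twice_fdiff (Kop kappa) ->
  (* phi is the unique solution of x - K(x) = f *)
  Xsp phi ->
  eqI (fsub phi (Kop kappa phi)) f ->
  (forall y, Xsp y -> eqI (fsub y (Kop kappa y)) f -> eqI y phi) ->
  (* 1 is not an eigenvalue of K'(phi) *)
  (forall L, is_fderiv (Kop kappa) phi L ->
     forall v, Xsp v -> eqI (L v) v -> eqI v (fun _ => 0)) ->
  (* Q n p is the (extended) discrete orthogonal projection *)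
  (forall n p, (0 < n)%N -> (0 < p)%N -> is_Qn n p (Q n p)) ->
  (* for n large enough, z - KtM(z) = f has a unique solution in B(phi,delta0) *)
  0 < delta0 ->
  (exists N0 : nat, forall n p, (N0 <= n)%N -> (0 < p)%N ->
     exists z, Xsp z /\ supn (fsub z phi) < delta0 /\
       eqI (fsub z (KtM kappa n p (Q n p) z)) f /\
       forall y, Xsp y -> supn (fsub y phi) < delta0 ->
         eqI (fsub y (KtM kappa n p (Q n p) y)) f -> eqI y z) ->
  exists C : R, exists N : nat, forall n p, (0 < n)%N -> (N <= n)%N -> (0 < p)%N ->
    forall z, Xsp z -> supn (fsub z phi) < delta0 ->
      eqI (fsub z (KtM kappa n p (Q n p) z)) f ->
      supn (fsub z phi) <=
        C * Num.max ((1 / (n * p)%:R) ^+ 2) ((1 / n%:R) ^+ 3).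
Proof.
move=> HG Hf _ Xphi phieq uniq eig HQ delta_gt0 _.
have [k1 [k2 [l1 [l2 P]]]] := class_G2_pieces HG.
have [F F0 rf] := C2_01_regular Hf.
have cf := lipI_continuous rf.1; have Xf := continuous_Xsp cf.
(* Nested boxes: [B0] bounds every z in the ball, [M0] bounds the kernel there, and [B] then bounds
   f + K_m z, hence also its averages Q z. The box of size [Bphi + 1] serves the Frechet
   derivative. *)
pose Bphi := supn phi; pose B0 := Bphi + delta0; pose Fb := supn f.
have Bphi0 : 0 <= Bphi by exact: supn_ge0.
have Fb0 : 0 <= Fb by exact: supn_ge0.
have [M0 H0] := kernel_boundP B0 P; have M00 := kb_ge0 H0.
pose B := B0 + Fb + M0.
have [M H] := kernel_boundP B P; have M_ge0 := kb_ge0 H.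
have [M1 H1] := kernel_boundP (Bphi + 1) P.
have bphi' : bddI Bphi phi by move=> t It; rewrite -ler_norml; exact: supn_ge.
have bphi : bddI B phi by move=> t It; have := bphi' t It; rewrite /B /B0; lra.
have phi_eq s : I01 s -> phi s = f s + Kop kappa phi s.
  by move=> Is; rewrite -phieq// /fsub subrK.
have rphi : regular (F + M) (F + 3 * M) phi.
  apply: (@regular_eqI _ _ _ (fun s => f s + Kop kappa phi s)).
    by move=> s Is; rewrite phi_eq.
  exact: regular_add rf (Kop_regular P H Xphi bphi).
have cphi := lipI_continuous rphi.1.
have reg_value v : Xsp v -> eqI (Lop kappa phi v) v -> eqI v (fun=> 0).
  exact: (eig _ (Kop_fderiv P H1 Xphi bphi') v).
have L0 : 0 <= F + M by rewrite addr_ge0.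
have T0 : 0 <= F + 3 * M by rewrite addr_ge0// mulr_ge0.
have [C [N hN]] := error_estimate P H F0 rf.1 Xphi bphi phi_eq uniq L0 T0 rphi reg_value.
exists C, N => n p n0 Nn p0 z Xz zd ez.
apply: (hN n p z (Q n p z) (Q n p phi) Nn).
have HQn := HQ n p n0 p0.
have [_ [_ [_ [_ Qcont]]]] := HQn.
have eqs := discrete_equation n0 p0 HQn P cf Xz ez.
have bz' : bddI B0 z.
  move=> t It; have := supn_ge (Xsp_sub Xz Xphi) It; rewrite /fsub ler_norml => h.
  by have := bphi' t It; rewrite /B0; lra.
have bv : bddI B (fun s => f s + Kmop kappa n p z s).
  move=> s Is; rewrite -ler_norml; apply: (le_trans (ler_normD _ _)).
  have h1 : `|f s| <= Fb by exact: supn_ge.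
  have h2 : `|Kmop kappa n p z s| <= M0.
    rewrite Kmop_nys; apply: nys_bound => // t It.
    by apply: (kb_bnd H0); apply: box_of => //; exact: bz'.
  by rewrite /B /B0; lra.
split => //.
- by move=> t It; have := bz' t It; rewrite /B; lra.
- move=> t It; have [j cj] := cell_exists n0 It.
  by rewrite (eqs j t cj).1; apply: qavg_bddI => //; case: cj.
- by move=> j t cj; exact: (eqs j t cj).1.
- by move=> j t cj; exact: (eqs j t cj).2.
- by move=> j t cj; exact: Qcont.
Qed.
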